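(* Let $N\ge1$ be an integer and $x\in[0,1]\setminus\mathbb{Q}$. For the growth rate of the lengths of the words $\Sigma_n=\sigma_1\circ\sigma_2\circ\cdots\circ\sigma_n(1)$ associated with $x$ one has the formula $$\lim_{n\to\infty}\frac1n\log(|\Sigma_n|)=\frac12\left(h(T_N)+\log(N)\right).$$
   Context: Define $T_N:[0,1]\to[0,1]$ by $T_N(x)=\frac{N}{x}-\lfloor\frac{N}{x}\rfloor$ for $x\ne0$ and $T_N(0)=0$. For $x\in[0,1]\setminus\mathbb{Q}$ let $d_n=\lfloor N/T_N^{n-1}(x)\rfloor\geq N$, $n\ge1$, be its (greedy) $N$-continued fraction digits, and let $\sigma_n$ be the substitution on $\{0,1\}$ with $\sigma_n(0)=0^{d_n}1^N$, $\sigma_n(1)=0$, extended to finite words by concatenation. $|\cdot|$ denotes word length. $h(T_N)$ is the measure-theoretic (Kolmogorov–Sinai) entropy of $T_N$ with respect to its invariant probability measure that is absolutely continuous with respect to Lebesgue measure.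
   Formalization: The formula is proved for Lebesgue-almost every irrational x in [0,1], not for every one; for every x it is false: N=1, x=(√5−1)/2 gives the limit log((1+√5)/2) ≈ 0.481, while the right-hand side is π²/(12 log 2) ≈ 1.187. *)

(* Defs.v *)
From HB Require Import structures.
From mathcomp Require Import all_boot all_order all_algebra.
From mathcomp Require Import all_classical all_reals all_analysis.

Set Implicit Arguments.
Unset Strict Implicit.
Unset Printing Implicit Defensive.

Import Order.TTheory GRing.Theory Num.Theory.
Import numFieldNormedType.Exports.

Local Open Scope classical_set_scope.
Local Open Scope ring_scope.

Section entropy.
Context d (X : measurableType d) (R : realType).
Variables (mu : probability X R) (T : X -> X).

Definition measure_preserving : Prop :=
  measurable_fun [set: X] T /\
  forall B : set X, measurable B -> mu (T @^-1` B) = mu B.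

Definition measurable_partition (k : nat) (A : 'I_k -> set X) : Prop :=
  partition [set: 'I_k] A [set: X] /\ forall i, measurable (A i).

(* The atoms of A \/ T^-1 A \/ ... \/ T^-(n-1) A are indexed by their
   itineraries w; itineraries that do not occur give the empty set, which
   contributes 0 to the entropy below because [0 * ln 0 = 0]. *)
Definition join_atom (k : nat) (A : 'I_k -> set X) (n : nat)
    (w : {ffun 'I_n -> 'I_k}) : set X :=
  [set x | forall i : 'I_n, A (w i) (iter i T x)].

Definition join_entropy (k : nat) (A : 'I_k -> set X) (n : nat) : R :=
  - \sum_(w : {ffun 'I_n -> 'I_k})
      (fine (mu (join_atom A w)) * ln (fine (mu (join_atom A w)))).

Definition partition_entropy (k : nat) (A : 'I_k -> set X) : R :=
  limn (fun n : nat => n%:R^-1 * join_entropy A n).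

Definition KS_entropy : \bar R :=
  ereal_sup [set h : \bar R | exists (k : nat) (A : 'I_k -> set X),
    measurable_partition A /\ h = (partition_entropy A)%:E].

End entropy.

Section N_continued_fractions.
Context (R : realType).

(* The formula is applied on all of R rather than on [0, 1] only; every value
   lies in [0, 1[, and the measures of interest are carried by [0, 1]. *)
Definition TN (N : nat) (x : R) : R :=
  if x == 0 then 0 else N%:R / x - (Num.floor (N%:R / x))%:~R.

(* Meaningful for n >= 1 and x an irrational number in [0, 1]. *)
Definition digit (N : nat) (x : R) (n : nat) : nat :=
  Num.truncn (N%:R / iter n.-1 (TN N) x).

Definition is_acip (N : nat) (mu : probability (measurableTypeR R) R) : Prop :=
  [/\ measure_preserving mu (TN N),
      mu `[0, 1]%classic = 1%E
    & mu `<< lebesgue_measure].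

End N_continued_fractions.

(* Words over {0, 1}: the letter 0 is [false] and the letter 1 is [true]. *)
Definition subst_letter (N d : nat) (a : bool) : seq bool :=
  if a then [:: false] else nseq d false ++ nseq N true.

Definition subst_word (N d : nat) (w : seq bool) : seq bool :=
  flatten [seq subst_letter N d a | a <- w].

(* sigma_1 (sigma_2 (... (sigma_n 1) ...)). *)
Definition Sigma_word (R : realType) (N : nat) (x : R) (n : nat) : seq bool :=
  foldr (fun i w => subst_word N (digit N x i) w) [:: true] (iota 1 n).

(* Main.v *)
(* The lengths v_n of the words satisfy
   u_n + T^n(x) v_n = (1 + x) \prod_(i < n) N / T^i(x), where u_n = v_(n+1), so
   that ln v_(n+1) is, up to ln 2, a Birkhoff sum of ln (N / x).  An invariant
   set fills the same proportion, up to a constant, of every cylinder; by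
   Lebesgue's density theorem T is ergodic, and Birkhoff averages show that the
   invariant probability is comparable to Lebesgue measure.  Hence ln (N / x) is
   integrable and the growth rate is its integral.

   As ln |T'(x)| = 2 ln (N / x) - ln N, it remains to show that the entropy is
   the integral of ln |T'| (Rokhlin).  The points r-close to x up to time n have
   Lebesgue measure about 1 / |(T^n)'(x)|; approximating the pieces of a
   partition by disjoint compact sets, this makes the Lebesgue probability of
   nearly following the itinerary of x a competitor in Gibbs' inequality, which
   bounds the entropy from above.  From below, a finite partition on which
   |T'| varies little has cells of Lebesgue measure at most about
   1 / |(T^n)'(x)|. *)

Require Import Defs.
From HB Require Import structures.
From mathcomp Require Import all_boot all_order all_algebra.
From mathcomp Require Import all_classical all_reals all_analysis.
From mathcomp Require Import measurable_realfun.
From mathcomp Require Import zify ring lra.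

Set Implicit Arguments.
Unset Strict Implicit.
Unset Printing Implicit Defensive.

Import Order.TTheory GRing.Theory Num.Theory.
Import numFieldNormedType.Exports.
Local Open Scope classical_set_scope.
Local Open Scope ring_scope.

Section lebesgue_expansion.
Context (R : realType).
Local Notation leb := (@lebesgue_measure R).

Lemma lebesgue_le_diam (S : set R) (D : R) : 0 <= D ->
  (forall x y, S x -> S y -> `|x - y| <= D) -> (leb S <= D%:E)%E.
Proof.
move=> D0 SD; have [->|/set0P[s Ss]] := eqVneq S set0; first by rewrite measure0.
have ubS : has_ubound S.
  by exists (s + D) => x Sx; have := SD _ _ Sx Ss; rewrite ler_norml; lra.
have lbS : has_lbound S.
  by exists (s - D) => x Sx; have := SD _ _ Sx Ss; rewrite ler_norml; lra.
have Ssub : S `<=` `[inf S, sup S]%classic.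
  by move=> x Sx /=; rewrite in_itv/= ge_inf//= ub_le_sup.
have SI : (leb S <= leb `[inf S, sup S]%classic)%E by exact: le_outer_measure.
apply: (le_trans SI).
rewrite lebesgue_measure_itv/=; case: ifPn => _; last by rewrite lee_fin.
rewrite -EFinB lee_fin lerBlDr.
apply: ge_sup; first by exists s.
move=> x Sx; rewrite -lerBlDl; apply: lb_le_inf; first by exists s.
by move=> y Sy; have := SD _ _ Sx Sy; rewrite ler_norml; lra.
Qed.

Lemma lebesgue_le_expanding (A B : set R) (g : R -> R) (L : R) : 0 < L ->
  (forall b, B b -> A (g b)) ->
  (forall b c, B b -> B c -> `|b - c| <= L * `|g b - g c|) ->
  (leb B <= L%:E * leb A)%E.
Proof.
move=> L0 gBA gL.
rewrite -lee_pdivrMl//; apply: le_ereal_inf_tmp => _ [F [mF AF] <-].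
rewrite lee_pdivrMl// -nneseriesZl//.
pose S k := B `&` g @^-1` F k.
have BS : B `<=` \bigcup_k S k.
  by move=> b Bb; have [k _ Fk] := AF _ (gBA _ Bb); exists k.
have BS' : (leb B <= leb (\bigcup_k S k))%E by exact: le_outer_measure.
have SS : (leb (\bigcup_k S k) <= \sum_(k <oo) leb (S k))%E.
  exact: outer_measure_sigma_subadditive.
apply: (le_trans BS'); apply: (le_trans SS).
apply: lee_nneseries => // k _; rewrite /=.
have /ocitvP[F0|[[a b] /= ab Fab]] := mF k.
  rewrite (_ : S k = set0) ?measure0 ?mule_ge0 ?wlength_ge0 ?lee_fin ?ltW//.
  by rewrite /S F0 preimage_set0 setI0.
rewrite Fab wlength_itv_bnd ?(ltW ab)//= -EFinM.
apply: lebesgue_le_diam; first by rewrite mulr_ge0 ?ltW// subr_gt0.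
move=> x y [Bx]; rewrite /= Fab/= in_itv/= => /andP[ax xb].
move=> [By]; rewrite /= Fab/= in_itv/= => /andP[ay yb].
apply: le_trans (gL _ _ Bx By) _; rewrite ler_pM2l//.
by rewrite ler_norml; lra.
Qed.

End lebesgue_expansion.

(** * Inverse branches and bounded distortion *)

Section branches.
Context (R : realType) (N : nat).
Hypothesis N_gt0 : (0 < N)%N.
Local Notation T := (@TN R N).
Local Notation a1 := (fun x : R => Num.truncn (N%:R / x)).

Let N0 : 0 < N%:R :> R. Proof. by rewrite ltr0n. Qed.
Let N1 : 1 <= N%:R :> R. Proof. by rewrite ler1n. Qed.

Lemma TN_ge0 x : 0 <= T x.
Proof. by rewrite /TN; case: ifPn => // _; rewrite subr_ge0 floor_le_tmp. Qed.

Lemma TN_lt1 x : T x < 1.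
Proof.
by rewrite /TN; case: ifPn => // _; rewrite ltrBlDl -intrD1 floorD1_gt.
Qed.

Lemma TN_branch x : 0 < x < 1 -> N%:R / x = (a1 x)%:R + T x.
Proof.
move=> /andP[x0 x1]; have Nx0 : 0 <= N%:R / x by rewrite divr_ge0 ?ltW.
rewrite /TN gt_eqF// truncn_floor Nx0.
have : 0 <= Num.floor (N%:R / x) by rewrite floor_ge0.
by case: (Num.floor _) => // n _; rewrite absz_nat -pmulrn; lra.
Qed.

Lemma TN_branch_le x : 0 < x < 1 -> (N <= a1 x)%N.
Proof.
move=> /andP[x0 x1]; rewrite truncn_ge_nat; last by rewrite divr_ge0 ?ltW.
by rewrite ler_pdivlMr// ler_piMr// ltW.
Qed.

Lemma TN_section (k : nat) (b : R) : (0 < k)%N -> 0 <= b < 1 ->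
  a1 (N%:R / (k%:R + b)) = k /\ T (N%:R / (k%:R + b)) = b.
Proof.
move=> k0 /andP[b0 b1]; have kR : 0 < k%:R :> R by rewrite ltr0n.
have kb : 0 < k%:R + b by lra.
have E : N%:R / (N%:R / (k%:R + b)) = k%:R + b.
  by rewrite invf_div mulrC divfK ?gt_eqF.
rewrite /TN E; split.
  by apply/truncn_def; rewrite -natr1; lra.
have F : Num.floor (k%:R + b) = k by apply/floor_def; rewrite intrD1; lra.
by rewrite F gt_eqF ?divr_gt0//; lra.
Qed.

(* The derivative of the n-th iterate of the map at x, up to sign. *)
Definition jac n x : R := \prod_(i < n) (N%:R / (iter i T x) ^+ 2).

Definition orbit_in n x := forall i, (i <= n)%N -> 0 < iter i T x < 1.

Definition same_digits n y z := forall i, (i < n)%N ->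
  a1 (iter i T y) = a1 (iter i T z).

Lemma orbit_inS n x : orbit_in n.+1 x -> orbit_in n x.
Proof. by move=> h i ni; apply: h; exact: leq_trans ni _. Qed.

Lemma orbit_in_TN n x : orbit_in n.+1 x -> orbit_in n (T x).
Proof. by move=> h i ni; rewrite -iterSr; exact: h. Qed.

Lemma orbit_dist n y z : orbit_in n y -> orbit_in n z -> same_digits n y z ->
  `|y - z| = `|iter n T y - iter n T z| *
    \prod_(i < n) (iter i T y * iter i T z / N%:R).
Proof.
elim: n => [|n IH] oy oz yz; first by rewrite big_ord0 mulr1.
rewrite IH; [|exact: orbit_inS|exact: orbit_inS|]; last first.
  by move=> i ni; apply: yz; exact: ltnW.
rewrite big_ord_recr/= mulrCA mulrC; congr (_ * _).
have yn := oy _ (leqnSn n); have zn := oz _ (leqnSn n).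
have yE := TN_branch yn; have zE := TN_branch zn.
rewrite (yz n (ltnSn n)) in yE.
have /andP[yn0 _] := yn; have /andP[zn0 _] := zn.
have -> : T (iter n T y) - T (iter n T z) =
    N%:R / iter n T y - N%:R / iter n T z by lra.
set p := iter n T y in yn0 *; set q := iter n T z in zn0 *.
have pq0 : 0 < p * q / N%:R by rewrite divr_gt0 ?mulr_gt0.
rewrite -[X in _ = _ * X]gtr0_norm// -normrM distrC; congr `|_|.
by field; rewrite !gt_eqF.
Qed.

Section continuants.
Variable d : nat -> nat.

Fixpoint continuants n : nat * nat :=
  if n is m.+1 then
    let: (u, v) := continuants m in (d n * u + N * v, u)%N
  else (1, 1)%N.

Lemma continuants_le n : (forall i, 0 < d i)%N ->
  (0 < (continuants n).2 <= (continuants n).1)%N.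
Proof.
move=> d0; elim: n => //= n; case: (continuants n) => u v /= /andP[v0 vu].
rewrite (leq_trans v0 vu)/=; apply: leq_trans (leq_addr _ _).
exact: leq_pmull.
Qed.

End continuants.

Lemma digitS (x : R) n : digit N x n.+1 = a1 (iter n T x).
Proof. by []. Qed.

Lemma eq_continuants d d' n : (forall i, (0 < i <= n)%N -> d i = d' i) ->
  continuants d n = continuants d' n.
Proof.
elim: n => //= n IH dd'.
rewrite IH; first by rewrite dd' ?leqnn.
by move=> i /andP[i0 ni]; apply: dd'; rewrite i0 leqW.
Qed.

Lemma continuantsE n x : orbit_in n x ->
  (continuants (digit N x) n).1%:R + iter n T x * (continuants (digit N x) n).2%:R =
  (1 + x) * \prod_(i < n) (N%:R / iter i T x).
Proof.
elim: n => [|n IH] ox; first by rewrite big_ord0 !mulr1.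
rewrite big_ord_recr/= [RHS]mulrA -IH; last exact: orbit_inS.
rewrite digitS; case: (continuants _ n) => u v /=.
have xn := ox _ (leqnSn n); have xE := TN_branch xn.
have /andP[xn0 _] := xn.
rewrite natrD !natrM.
have -> : T (iter n T x) = N%:R / iter n T x - (a1 (iter n T x))%:R by lra.
by field; rewrite gt_eqF.
Qed.

Lemma orbit_digit_gt0 n x i : orbit_in n x -> (0 < i <= n)%N ->
  (0 < digit N x i)%N.
Proof.
case: i => // i ox /= ni; rewrite digitS.
exact/(leq_trans N_gt0)/TN_branch_le/ox/ltnW.
Qed.

Lemma orbit_prod_bounds n x : orbit_in n x ->
  let u := (continuants (digit N x) n).1%:R in
  let p := \prod_(i < n) (N%:R / iter i T x) in
  0 < u /\ p / 2 <= u <= 2 * p.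
Proof.
move=> ox u p.
pose d i := maxn 1 (digit N x i).
have dE : continuants (digit N x) n = continuants d n.
  by apply: eq_continuants => i /(orbit_digit_gt0 ox) di; exact/esym/maxn_idPr.
have := continuants_le n (fun i => leq_maxl 1 (digit N x i) : (0 < d i)%N).
have := continuantsE ox; rewrite -/p /u dE.
case: (continuants _ n) => /= {u} u v uv /andP[v0 vu].
have {}v0 : 0 < v%:R :> R by rewrite ltr0n.
have {}vu : v%:R <= u%:R :> R by rewrite ler_nat.
have /andP[xn0 xn1] := ox _ (leqnn n); have /andP[x0 x1] := ox _ (leq0n n).
have p0 : 0 < p.
  by apply: prodr_gt0 => i _; rewrite divr_gt0//; have /andP[] := ox i (ltnW (ltn_ord i)).
have h1 : iter n T x * v%:R <= v%:R by rewrite ler_piMl// ltW.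
have h2 : 0 < iter n T x * v%:R by rewrite mulr_gt0.
have h3 : x * p <= p by rewrite ler_piMl// ltW.
have h4 : 0 < x * p by rewrite mulr_gt0.
lra.
Qed.

Lemma size_Sigma_word (x : R) n :
  size (Sigma_word N x n) = (continuants (digit N x) n).2.
Proof.
have H w : size (foldr (fun i w => subst_word N (digit N x i) w) w (iota 1 n)) =
    ((continuants (digit N x) n).1 * count_mem false w +
     (continuants (digit N x) n).2 * count_mem true w)%N.
  elim: n w => [|n IH] w.
    rewrite /= !mul1n -(count_predC (pred1 false)); congr addn.
    by apply: eq_count => -[].
  rewrite -(addn1 n) iotaD foldr_cat add1n/= addn1 IH /=.
  case: (continuants _ n) => u v /=.
  have -> : count_mem false (subst_word N (digit N x n.+1) w) =
      (digit N x n.+1 * count_mem false w + count_mem true w)%N.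
    rewrite /subst_word; elim: w {IH} => [|a w IHw]; first by rewrite muln0.
    by rewrite /= count_cat IHw; case: a => /=; rewrite ?count_cat ?count_nseq/=; lia.
  have -> : count_mem true (subst_word N (digit N x n.+1) w) =
      (N * count_mem false w)%N.
    rewrite /subst_word; elim: w {IH} => [|a w IHw]; first by rewrite muln0.
    by rewrite /= count_cat IHw; case: a => /=; rewrite ?count_cat ?count_nseq/=; lia.
  by ring.
by rewrite /Sigma_word H /=; lia.
Qed.

(* Both numbers are the continuant of the shared digits up to a factor 2. *)
Lemma orbit_prod_le n y z : orbit_in n y -> orbit_in n z -> same_digits n y z ->
  \prod_(i < n) (N%:R / iter i T y) <= 4 * \prod_(i < n) (N%:R / iter i T z).
Proof.
move=> oy oz yz.
have [u0 /andP[uy _]] := orbit_prod_bounds oy.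
have [_ /andP[_ uz]] := orbit_prod_bounds oz.
rewrite (@eq_continuants (digit N y) (digit N z)) in uy; first lra.
by case=> // i /= /yz; rewrite !digitS.
Qed.

Lemma jacE n x : jac n x = (\prod_(i < n) (N%:R / iter i T x)) ^+ 2 / N%:R ^+ n.
Proof.
rewrite (_ : N%:R ^+ n = \prod_(i < n) N%:R); last by rewrite prodr_const card_ord.
rewrite -prodrXl -prodf_div.
apply: eq_bigr => i _; rewrite expr_div_n.
have [->|xi] := eqVneq (iter i T x) 0; first by rewrite expr0n/= invr0 !mulr0 mul0r.
by field; rewrite xi gt_eqF.
Qed.

Lemma jac_gt0 n x : orbit_in n x -> 0 < jac n x.
Proof.
move=> ox; apply: prodr_gt0 => i _; rewrite divr_gt0// exprn_gt0//.
by have /andP[] := ox i (ltnW (ltn_ord i)).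
Qed.

Lemma jacS n x : jac n.+1 x = jac n x * (N%:R / iter n T x ^+ 2).
Proof. by rewrite /jac big_ord_recr. Qed.

Lemma jac_ge n x : orbit_in n x -> n.+1%:R <= 2 * jac n x.
Proof.
suff H m : orbit_in m.+1 x -> (m.+1%:R <= 2 * jac m x) /\ (m.+2%:R <= 2 * jac m.+1 x).
  case: n => [_|n ox]; last by have [] := H _ ox.
  by rewrite /jac big_ord0; lra.
elim: m => [|m IH] ox.
  have /andP[/= x0 x1] := ox 0%N isT.
  rewrite jacS /jac big_ord0 mul1r /=; split; first lra.
  have : 1 <= N%:R / x ^+ 2 by rewrite ler_pdivlMr ?exprn_gt0//; move: N1; nra.
  lra.
have [IH0 IH1] := IH (orbit_inS ox); split => //.
have om : orbit_in m x by exact/orbit_inS/orbit_inS.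
rewrite !jacS -mulrA; set c := (X in jac m x * X).
suff c4 : 4 <= c.
  apply: (@le_trans _ _ (2 * (jac m x * 4))).
    have : 0 <= m%:R :> R by [].
    by move: IH0; rewrite -!natr1; lra.
  by rewrite ler_pM2l// ler_pM2l// jac_gt0.
have mm : (m <= m.+2)%N by rewrite !leqW.
have xm := ox m (leqW (leqnSn m)); have /andP[y0 y1] := ox m.+1 (leqnSn _).
have xE := TN_branch xm; have := TN_branch_le xm.
rewrite -(ler_nat R) => aN; have /andP[x0 x1] := xm.
rewrite /c iterS -/(iter m.+1 T x) /=; move: xE aN y0 y1; rewrite iterS.
set p := iter m T x in x0 x1 *; set q := T p; set a := (Num.truncn _)%:R.
move=> xE aN q0 q1.
have pE : p = N%:R / (a + q) by rewrite -xE invf_div mulrC divfK ?gt_eqF.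
have aq : 0 < a + q by move: N0; lra.
have -> : N%:R / p ^+ 2 * (N%:R / q ^+ 2) = ((a + q) / q) ^+ 2.
  by rewrite pE; field; rewrite !gt_eqF.
have : 2 <= (a + q) / q by rewrite ler_pdivlMr//; move: N1; lra.
by nra.
Qed.

Fixpoint branch n (x b : R) : R :=
  if n is m.+1 then N%:R / ((a1 x)%:R + branch m (T x) b) else b.

Lemma branchP n x b : orbit_in n x -> 0 < b < 1 ->
  [/\ orbit_in n (branch n x b), same_digits n (branch n x b) x &
      iter n T (branch n x b) = b].
Proof.
move=> + b01; elim: n x => [|n IH] x ox /=; first by split => // -[].
have [oy yx Ey] := IH _ (orbit_in_TN ox).
have /andP[y0 y1] := oy 0%N isT; rewrite /= in y0 y1.
have x01 := ox 0%N isT; have aN := TN_branch_le x01.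
have a0 : (0 < a1 x)%N by exact: leq_trans aN.
have y01 : 0 <= branch n (T x) b < 1 by rewrite ltW.
have [] := TN_section a0 y01; rewrite /=; set z := N%:R / (_ + _) => Az Tz.
have z01 : 0 < z < 1.
  have : N%:R <= (a1 x)%:R :> R by rewrite ler_nat.
  move=> aNR; have ab0 : 0 < (a1 x)%:R + branch n (T x) b by move: N0; lra.
  by rewrite /z divr_gt0//= ltr_pdivrMr ?mul1r//; lra.
split.
- by case=> // i; rewrite ltnS iterSr Tz; exact: oy.
- by case=> // i; rewrite ltnS !iterSr Tz; exact: yx.
- by rewrite -iterS iterSr Tz.
Qed.

Lemma jac_dist n y z : orbit_in n y -> orbit_in n z -> same_digits n y z ->
  `|iter n T y - iter n T z| <= 4 * jac n y * `|y - z| /\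
  jac n y * `|y - z| <= 4 * `|iter n T y - iter n T z|.
Proof.
move=> oy oz yz; rewrite (orbit_dist oy oz yz).
have p0 w : orbit_in n w -> 0 < \prod_(i < n) (N%:R / iter i T w).
  move=> ow; apply: prodr_gt0 => i _; rewrite divr_gt0//.
  by have /andP[] := ow i (ltnW (ltn_ord i)).
have yz1 := orbit_prod_le oy oz yz.
have yz2 : \prod_(i < n) (N%:R / iter i T z) <= 4 * \prod_(i < n) (N%:R / iter i T y).
  by apply: orbit_prod_le => // i ni; rewrite yz.
rewrite jacE.
have -> : \prod_(i < n) (iter i T y * iter i T z / N%:R) = N%:R ^+ n /
   ((\prod_(i < n) (N%:R / iter i T y)) * \prod_(i < n) (N%:R / iter i T z)).
  rewrite (_ : N%:R ^+ n = \prod_(i < n) N%:R); last by rewrite prodr_const card_ord.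
  rewrite -big_split -prodf_div/=.
  apply: eq_bigr => i _.
  have /andP[yi _] := oy i (ltnW (ltn_ord i)); have /andP[zi _] := oz i (ltnW (ltn_ord i)).
  by field; rewrite !gt_eqF.
move: (p0 _ oy) (p0 _ oz) yz1 yz2.
set p := \prod_(i < n) (N%:R / iter i T y); set q := \prod_(i < n) _.
move=> p0' q0 pq qp; set D := `|_ - _|; have D0 : 0 <= D by exact: normr_ge0.
have Nn : 0 < N%:R ^+ n :> R by rewrite exprn_gt0.
have E : p ^+ 2 / N%:R ^+ n * (D * (N%:R ^+ n / (p * q))) = D * (p / q).
  by field; rewrite !gt_eqF.
rewrite -mulrA E; split.
  rewrite mulrCA ler_peMr// mulrA ler_pdivlMr// mul1r; lra.
by rewrite mulrC ler_wpM2r// ler_pdivrMr//; lra.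
Qed.

Lemma jac_le n y z : orbit_in n y -> orbit_in n z -> same_digits n y z ->
  jac n y <= 16 * jac n z.
Proof.
move=> oy oz yz; rewrite !jacE mulrA ler_pM2r ?invr_gt0 ?exprn_gt0//.
have -> : 16 = 4 ^+ 2 :> R by rewrite -natrX.
rewrite -exprMn ler_pXn2r ?nnegrE//; [exact: orbit_prod_le| |].
- apply: prodr_ge0 => i _; rewrite divr_ge0//.
  by have /andP[/ltW] := oy i (ltnW (ltn_ord i)).
- rewrite mulr_ge0//; apply: prodr_ge0 => i _; rewrite divr_ge0//.
  by have /andP[/ltW] := oz i (ltnW (ltn_ord i)).
Qed.

Lemma branch_expanding n x b c : orbit_in n x -> 0 < b < 1 -> 0 < c < 1 ->
  `|b - c| <= 64 * jac n x * `|branch n x b - branch n x c|.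
Proof.
move=> ox b01 c01.
have [ob bx Eb] := branchP ox b01; have [oc cx Ec] := branchP ox c01.
have bc : same_digits n (branch n x b) (branch n x c).
  by move=> i ni; rewrite bx// cx.
have [+ _] := jac_dist ob oc bc; rewrite Eb Ec => /le_trans; apply.
by rewrite ler_wpM2r//; have := jac_le ob ox bx; lra.
Qed.

Lemma branch_close n x b : orbit_in n x -> 0 < b < 1 ->
  `|x - branch n x b| < 4 / jac n x.
Proof.
move=> ox b01; have [ob bx Eb] := branchP ox b01.
have xb : same_digits n x (branch n x b) by move=> i ni; rewrite bx.
have [_] := jac_dist ox ob xb; rewrite Eb.
have J := jac_gt0 ox; rewrite ltr_pdivlMr// mulrC => /le_lt_trans; apply.
have /andP[y0 y1] := ox n (leqnn n); have /andP[b0 b1] := b01.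
have : `|iter n T x - b| < 1 by rewrite ltr_norml; lra.
lra.
Qed.

Lemma iter_TN_contracting n y z x : orbit_in n y -> orbit_in n z ->
  orbit_in n x -> same_digits n y x -> same_digits n z x ->
  `|y - z| <= 64 / jac n x * `|iter n T y - iter n T z|.
Proof.
move=> oy oz ox yx zx.
have yz : same_digits n y z by move=> i ni; rewrite yx// zx.
have xy : same_digits n x y by move=> i ni; rewrite yx.
have [_ h] := jac_dist oy oz yz.
have J := jac_gt0 ox; have := jac_le ox oy xy => h2.
rewrite mulrAC ler_pdivlMr//.
apply: (@le_trans _ _ (16 * (jac n y * `|y - z|))); last by lra.
by rewrite mulrA mulrC ler_wpM2r.
Qed.

Lemma orbit_contract n y z : orbit_in n y -> orbit_in n z -> same_digits n y z ->
  `|y - z| <= `|iter n T y - iter n T z|.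
Proof.
move=> oy oz yz; rewrite (orbit_dist oy oz yz) ler_piMr//.
apply: prodr_ile1 => i _.
have /andP[y0 y1] := oy i (ltnW (ltn_ord i)).
have /andP[z0 z1] := oz i (ltnW (ltn_ord i)).
rewrite divr_ge0 ?mulr_ge0 ?(ltW y0) ?(ltW z0)//= ler_pdivrMr//.
by rewrite mul1r; apply: le_trans N1; rewrite mulr_ile1 ?ltW.
Qed.

Lemma orbit_contract_iter n i y z : (i <= n)%N ->
  orbit_in n y -> orbit_in n z -> same_digits n y z ->
  `|iter i T y - iter i T z| <= `|iter n T y - iter n T z|.
Proof.
move=> ni oy oz yz; rewrite -[in leRHS](subnK ni) !iterD; apply: orbit_contract => j nj; rewrite -!iterD.
- by apply: oy; lia.
- by apply: oz; lia.
- by apply: yz; lia.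
Qed.

End branches.

(** * Measurability *)

Section measurability.
Context (R : realType) (N : nat).
Hypothesis N_gt0 : (0 < N)%N.
Local Notation T := (@TN R N).
Local Notation a1 := (fun x : R => Num.truncn (N%:R / x)).

Lemma measurable_fun_nat d (X : measurableType d) (f : X -> nat) :
  (forall k, measurable (f @^-1` [set k])) -> measurable_fun setT f.
Proof.
move=> mf _ A _; rewrite setTI.
have -> : f @^-1` A = \bigcup_(k in A) (f @^-1` [set k]).
  by apply/seteqP; split => [x Ax|x [k Ak /= ->]//]; exists (f x).
exact: bigcup_measurable.
Qed.

Lemma measurable_inv : measurable_fun [set: R] (@GRing.inv R).
Proof.
rewrite -(setUv [set (0 : R)]); apply/measurable_funU => //.
  exact: measurableC.
split; first exact: measurable_fun_set1.
apply: open_continuous_measurable_fun.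
  by apply: closed_openC; exact: closed_eq.
by move=> x; rewrite inE /= => /eqP x0; exact: inv_continuous.
Qed.

Lemma measurable_floor : measurable_fun [set: R] (fun x => (Num.floor x)%:~R : R).
Proof.
by apply: nondecreasing_measurable => // x y xy; rewrite ler_int le_floor.
Qed.

Lemma measurable_truncn : measurable_fun [set: R] (@Num.truncn R).
Proof.
apply: measurable_fun_nat => k.
have m : measurable_fun [set: R] (fun x => (Num.truncn x)%:R : R).
  by apply: nondecreasing_measurable => // x y xy; rewrite ler_nat le_truncn.
have := m measurableT [set k%:R] (measurable_set1 _); rewrite setTI.
congr measurable; apply/seteqP; split => x /=; last by move->.
by move=> /eqP; rewrite eqr_nat => /eqP.
Qed.

Lemma measurable_Ndiv : measurable_fun [set: R] (fun x => N%:R / x).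
Proof. by apply: measurable_funM => //; exact: measurable_inv. Qed.

Lemma measurable_TN : measurable_fun [set: R] T.
Proof.
have -> : T = (fun x => N%:R / x - (Num.floor (N%:R / x))%:~R).
  apply/funext => x; rewrite /TN; case: eqVneq => [->|//].
  by rewrite invr0 mulr0 floor0 subrr.
apply: measurable_funB; first exact: measurable_Ndiv.
exact: measurableT_comp measurable_floor measurable_Ndiv.
Qed.

Lemma measurable_iter d (X : measurableType d) (f : X -> X) n :
  measurable_fun setT f -> measurable_fun setT (iter n f).
Proof.
move=> mf; elim: n => [|n IH]; first exact: measurable_id.
exact: measurableT_comp mf IH.
Qed.

Lemma measurable_first_digit : measurable_fun [set: R] a1.
Proof. exact: measurableT_comp measurable_truncn measurable_Ndiv. Qed.

(* The points whose orbit never reaches an endpoint; it contains all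
   irrational numbers of the unit interval. *)
Definition regular_points := [set x : R | forall i, 0 < iter i T x < 1].

Lemma regular_orbit_in x n : regular_points x -> orbit_in N n x.
Proof. by move=> rx i _; exact: rx. Qed.

Lemma regular_TN x : regular_points x -> regular_points (T x).
Proof. by move=> rx i; rewrite -iterSr; exact: rx. Qed.

Lemma regular_iter x n : regular_points x -> regular_points (iter n T x).
Proof. by elim: n => //= n IH rx; exact/regular_TN/IH. Qed.

Lemma regular_branch n x b : regular_points x -> regular_points b ->
  regular_points (branch N n x b).
Proof.
move=> rx rb; have [ob _ Eb] := branchP N_gt0 (regular_orbit_in (n := n) rx) (rb 0%N).
move=> i; have [/ob//|ni] := leqP i n.
by rewrite -(subnK (ltnW ni)) iterD Eb; exact: rb.
Qed.

Lemma measurable_regular : measurable regular_points.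
Proof.
have -> : regular_points = \bigcap_i (iter i T @^-1` `]0, 1[%classic).
  apply/seteqP; split => x h i; first by move=> _ /=; rewrite in_itv/=; exact: h.
  by have := h i I; rewrite /= in_itv.
apply: bigcapT_measurable => i; rewrite -[X in measurable X]setTI.
exact: measurable_iter measurable_TN _ _ (measurable_itv _).
Qed.

Lemma irrational_regular x : 0 <= x <= 1 -> irrational x -> regular_points x.
Proof.
suff H i y : 0 <= y <= 1 -> irrational y ->
    0 < iter i T y < 1 /\ irrational (iter i T y).
  by move=> x01 ix i; have [] := H i _ x01 ix.
move=> y01 iy; elim: i => [|i [/andP[z0 z1] iz]] /=.
  split => //; have /andP[y0 y1] := y01.
  rewrite !lt_neqAle y0 y1 !andbT; apply/andP; split; apply/eqP => yE; apply: iy.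
  - by exists 0; rewrite // rmorph0.
  - by exists 1; rewrite // rmorph1.
set z := iter i T y in z0 z1 iz *.
have iTz : irrational (T z).
  move=> [q _ qE]; apply: iz.
  exists (N%:R / ((Num.truncn (N%:R / z))%:R + q)) => //.
  rewrite fmorph_div rmorphD !rmorph_nat/= qE.
  rewrite -TN_branch//; last by rewrite z0.
  by rewrite invf_div mulrC divfK// pnatr_eq0 -lt0n.
split => //; rewrite TN_lt1 andbT lt_neqAle TN_ge0 andbT.
by apply/eqP => yE; apply: iTz; exists 0; rewrite // rmorph0.
Qed.

Lemma lebesgue_nonregular : lebesgue_measure (`[0, 1]%classic `\` regular_points) = 0%E.
Proof.
apply: (@subset_measure0 _ _ _ (@lebesgue_measure R) _ (range (@ratr R))).
- by apply: measurableD => //; exact: measurable_regular.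
- have -> : range (@ratr R) = \bigcup_(q : rat) [set ratr q].
    by apply/seteqP; split => [x [q _ <-]|x [q _ /= ->]]; exists q.
  by apply: bigcupT_measurable_rat => q; exact: measurable_set1.
- move=> x [/=]; rewrite in_itv/= => x01 rx; apply: contrapT => qx; apply: rx.
  exact: irrational_regular.
- exact: lebesgue_measure_rat.
Qed.

Lemma lebesgue_regular : lebesgue_measure regular_points = 1%E.
Proof.
have D01 : regular_points `<=` `[0, 1]%classic.
  by move=> x /(_ 0%N)/andP[x0 x1]; rewrite /= in_itv/= !ltW.
have := lebesgue_measure_itv `[(0 : R), 1]; rewrite /= lte_fin ltr01 oppr0 adde0 => <-.
rewrite -[in RHS](setDUK D01) measureU//; last 3 first.
- exact: measurable_regular.
- by apply: measurableD => //; exact: measurable_regular.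
- by apply/seteqP; split => x //= [? []].
rewrite [X in _ = (_ + X)%E](_ : _ = 0%E) ?adde0//; exact: lebesgue_nonregular.
Qed.

End measurability.

(** * Birkhoff's ergodic theorem *)

Section measure_preserving_integral.
Context d (X : measurableType d) (R : realType) (mu : probability X R) (T : X -> X).
Hypothesis T_mp : measure_preserving mu T.
Local Open Scope ereal_scope.

Lemma mp_ge0_integral (f : X -> \bar R) : measurable_fun setT f ->
  (forall x, 0 <= f x) -> \int[mu]_x f (T x) = \int[mu]_x f x.
Proof.
move=> mf f0; have [mT Tinv] := T_mp.
have := ge0_integral_pushforward mT mu measurableT mf (fun x _ => f0 x).
rewrite preimage_setT => <-.
apply: eq_measure_integral => A mA _; exact: Tinv.
Qed.

Lemma mp_integrable (f : X -> \bar R) :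
  mu.-integrable setT f -> mu.-integrable setT (f \o T).
Proof.
move=> /integrableP[mf fi]; have [mT _] := T_mp.
apply/integrableP; split; first exact: measurableT_comp.
have mAf : measurable_fun setT (abse \o f) by exact: measurableT_comp.
by have /= -> := mp_ge0_integral mAf (fun x => abse_ge0 (f x)).
Qed.

Lemma mp_integral (f : X -> \bar R) :
  mu.-integrable setT f -> \int[mu]_x f (T x) = \int[mu]_x f x.
Proof.
move=> fi; have mf := measurable_int mu fi.
rewrite [LHS]integralE [RHS]integralE.
rewrite -(mp_ge0_integral (measurable_funepos mf) (funepos_ge0 f)).
rewrite -(mp_ge0_integral (measurable_funeneg mf) (funeneg_ge0 f)).
have -> : (fun x => f (T x))^\+ = f^\+ \o T by exact: funepos_comp.
by have -> : (fun x => f (T x))^\- = f^\- \o T by exact: funeneg_comp.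
Qed.

Lemma mp_iter_measure m B : measurable B -> mu (iter m T @^-1` B) = mu B.
Proof.
move=> mB; have [mT Tinv] := T_mp.
elim: m => // m IH; have mB' : measurable (iter m T @^-1` B).
  rewrite -[X in measurable X]setTI; elim: (m) B mB {IH} => [|j IHj] B mB; first by rewrite setTI.
  rewrite -[X in measurable X]/(setT `&` iter j T @^-1` (T @^-1` B)).
  by apply: IHj; rewrite -[X in measurable X]setTI; exact: mT.
rewrite -IH -[RHS]Tinv//; congr (mu _).
by apply/seteqP; split => x; rewrite /preimage/= -iterSr.
Qed.

Lemma mp_iter_integrable (f : X -> \bar R) m :
  mu.-integrable setT f -> mu.-integrable setT (fun x => f (iter m T x)).
Proof.
move=> fi; elim: m => // m IH; have := mp_integrable IH.
by apply: eq_integrable => // x _; rewrite /= -iterSr.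
Qed.

Lemma mp_iter_integral (f : X -> \bar R) m :
  mu.-integrable setT f -> \int[mu]_x f (iter m T x) = \int[mu]_x f x.
Proof.
move=> fi; elim: m => // m IH; rewrite -IH -(mp_integral (mp_iter_integrable m fi)).
by apply: eq_integral => x _; rewrite -iterSr.
Qed.

End measure_preserving_integral.

Section birkhoff.
Context d (X : measurableType d) (R : realType) (mu : probability X R) (T : X -> X).
Hypothesis T_mp : measure_preserving mu T.
Hypothesis T_ergodic : forall E, measurable E -> T @^-1` E = E ->
  mu E = 0%E \/ mu E = 1%E.

Definition birkhoff_sum (g : X -> R) n x : R := \sum_(i < n) g (iter i T x).

Lemma birkhoff_sumS g n x : birkhoff_sum g n.+1 x = g x + birkhoff_sum g n (T x).
Proof.
rewrite /birkhoff_sum big_ord_recl; congr +%R.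
by apply: eq_bigr => i _; rewrite -iterSr.
Qed.

Let mT : measurable_fun setT T. Proof. by case: T_mp. Qed.

Lemma birkhoff_sum_integral g m n :
  mu.-integrable setT (EFin \o g) -> (\int[mu]_x (g x)%:E = m%:E)%E ->
  mu.-integrable setT (EFin \o birkhoff_sum g n) /\
  (\int[mu]_x (birkhoff_sum g n x)%:E = (n%:R * m)%:E)%E.
Proof.
move=> gi gm; elim: n => [|n [IHi IHm]].
  have E0 : birkhoff_sum g 0 = cst 0 by apply/funext => x; rewrite /birkhoff_sum big_ord0.
  by rewrite E0 mul0r; split; [exact: integrable0|exact: integral0].
have E : birkhoff_sum g n.+1 = g \+ (birkhoff_sum g n \o T).
  by apply/funext => x; exact: birkhoff_sumS.
have i1 : mu.-integrable setT (EFin \o (birkhoff_sum g n \o T)).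
  by have := mp_integrable T_mp IHi.
rewrite E; split.
  by have := integrableD measurableT gi i1; apply: eq_integrable.
rewrite (_ : (\int[mu]_x _ = \int[mu]_x ((g x)%:E + (birkhoff_sum g n (T x))%:E))%E)//.
rewrite integralD// gm (mp_integral T_mp IHi) IHm -EFinD -natr1; congr EFin; lra.
Qed.

(* The maximum of the Birkhoff sums of length at most n, the empty sum included. *)
Fixpoint birkhoff_max (g : X -> R) n x : R :=
  if n is m.+1 then Num.max 0 (g x + birkhoff_max g m (T x)) else 0.

Lemma birkhoff_max_ge0 g n x : 0 <= birkhoff_max g n x.
Proof. by case: n => //= n; rewrite le_max lexx. Qed.

Lemma birkhoff_sum_le_max g n x : birkhoff_sum g n x <= birkhoff_max g n x.
Proof.
elim: n x => [|n IH] x; first by rewrite /birkhoff_sum big_ord0.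
by rewrite birkhoff_sumS /= le_max lerD2l IH orbT.
Qed.

Lemma birkhoff_max_leS g n x : birkhoff_max g n x <= birkhoff_max g n.+1 x.
Proof.
elim: n x => [|n IH] x; first exact: birkhoff_max_ge0.
by rewrite [leLHS]/= [leRHS]/= ge_max !le_max lexx/= lerD2l IH orbT.
Qed.

Lemma birkhoff_max_homo g x : {homo (birkhoff_max g)^~ x : n m / (n <= m)%N >-> n <= m}.
Proof. by apply: homo_leq => // [y|n]; [exact: le_trans|exact: birkhoff_max_leS]. Qed.

Section bounded.
Variable g : X -> R.
Hypothesis g_int : mu.-integrable setT (EFin \o g).

Let mg : measurable_fun setT g.
Proof. exact/measurable_EFinP/(measurable_int mu). Qed.

Let mM n : measurable_fun setT (birkhoff_max g n).
Proof.
elim: n => [|n IH]; first exact: measurable_cst.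
apply: measurable_maxr; first exact: measurable_cst.
by apply: measurable_funD => //; exact: measurableT_comp.
Qed.

Let iM n : mu.-integrable setT (EFin \o birkhoff_max g n).
Proof.
elim: n => [|n IH]; first exact: integrable0.
have i1 : mu.-integrable setT ((EFin \o g) \+ ((EFin \o birkhoff_max g n) \o T))%E.
  by apply: integrableD => //; exact: mp_integrable.
apply: le_integrable i1 => //; first exact/measurable_EFinP.
move=> x _ /=; rewrite lee_fin ger0_norm ?le_max ?lexx//.
by rewrite ge_max normr_ge0/= ler_norm.
Qed.

Definition birkhoff_unbounded := [set x | forall A : nat, exists n, A%:R < birkhoff_max g n x].

Let E := birkhoff_unbounded.

Let mE : measurable E.
Proof.
have -> : E = \bigcap_(A : nat) \bigcup_n [set x | A%:R < birkhoff_max g n x].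
  apply/seteqP; split => x h A; first by move=> _; have [n ?] := h A; exists n.
  by have [n _ ?] := h A I; exists n.
apply: bigcapT_measurable => A; apply: bigcupT_measurable => n.
rewrite -[X in measurable X]setTI.
have := @measurable_fun_ltr _ _ _ setT (cst A%:R) _ (measurable_cst _) (mM n).
by move=> /(_ measurableT [set true]); exact.
Qed.

Let TE : T @^-1` E = E.
Proof.
apply/seteqP; split => x; rewrite /E /birkhoff_unbounded/= => h A.
  have [n] := h (Num.truncn `|A%:R - g x|).+1; exists n.+1 => /=.
  rewrite lt_max; apply/orP; right.
  have := truncnS_gt `|A%:R - g x|; have := ler_norm (A%:R - g x); lra.
have [n] := h (Num.truncn `|A%:R + g x|).+1.
have t1 := truncnS_gt `|A%:R + g x|; have t2 := ler_norm (A%:R + g x).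
case: n => /= [|n]; first by rewrite ltNge ler0n.
by rewrite lt_max ltNge ler0n/= => t3; exists n; lra.
Qed.

Let Tint (f : X -> R) : mu.-integrable setT (EFin \o f) ->
  (\int[mu]_(x in E) (f (T x))%:E = \int[mu]_(x in E) (f x)%:E)%E.
Proof.
move=> fi; rewrite [LHS]integral_mkcond [RHS]integral_mkcond.
rewrite -(mp_integral T_mp (f := ((EFin \o f) \_ E))); last first.
  by apply/(integrable_mkcond _ mE); exact: integrableS fi.
have TEx x : E (T x) = E x by rewrite -[E (T x)]/((T @^-1` E) x) TE.
apply: eq_integral => x _; rewrite /patch (_ : (T x \in E) = (x \in E))//.
by apply/idP/idP => /set_mem h; apply/mem_set; move: h; rewrite TEx.
Qed.

Lemma birkhoff_unbounded_integral_ge0 : (0 <= \int[mu]_(x in E) (g x)%:E)%E.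
Proof.
pose D n x := birkhoff_max g n.+1 x - birkhoff_max g n (T x).
have DE n x : D n x = Num.max (- birkhoff_max g n (T x)) (g x).
  by rewrite /D /= addr_maxl sub0r addrK.
have iMT n : mu.-integrable setT (EFin \o (birkhoff_max g n \o T)).
  by rewrite compA; exact: mp_integrable.
have iS f : mu.-integrable setT (EFin \o f) -> mu.-integrable E (EFin \o f).
  by move=> fi; exact: integrableS fi.
have D_ge0 n : (0 <= \int[mu]_(x in E) (D n x)%:E)%E.
  rewrite integralB_EFin//; [|exact/iS/iM|exact/iS/iMT].
  rewrite (Tint (iM n)) sube_ge0; last first.
    by apply/orP; right; apply: integrable_fin_num => //; exact/iS/iM.
  apply: le_integral => //; [exact/iS/iM|exact/iS/iM|].
  by move=> x _; rewrite lee_fin birkhoff_max_leS.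
have mS f : measurable_fun setT f -> measurable_fun E (EFin \o f).
  by move=> mf; apply/measurable_EFinP; exact: measurable_funTS.
have [] := @dominated_convergence _ _ _ mu E mE (fun n => EFin \o D n) (EFin \o g)
  (EFin \o (fun x => `|g x|)).
- move=> n; apply: mS; apply: measurable_funB; first exact: mM.
  exact: measurableT_comp (mM n) mT.
- exact: mS.
- apply: aeW => x Ex; apply: cvg_near_cst.
  have : E (T x) by rewrite -[E (T x)]/((T @^-1` E) x) TE.
  move=> /(_ (Num.truncn `|g x|).+1)[n0 Mn0].
  exists n0 => // n /= n0n; congr EFin; rewrite DE; apply/max_idPr.
  have := birkhoff_max_homo g (T x) n0n; have := truncnS_gt `|g x|.
  by have := ler_norm (- g x); rewrite normrN; lra.
- by apply: iS; exact: integrable_norm.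
- apply: aeW => x n _; rewrite /= lee_fin DE.
  have m0 := birkhoff_max_ge0 g n (T x).
  by rewrite ler_norml ge_max le_max lerNl; have := ler_norm (g x);
    have := ler_norm (- g x); rewrite normrN; case: lerP; lra.
- move=> _ _ Dg; rewrite -(cvg_lim _ Dg)//; apply: lime_ge.
    by apply/cvg_ex; eexists; exact: Dg.
  exact: nearW.
Qed.

Lemma birkhoff_unbounded_null : (\int[mu]_x (g x)%:E < 0)%E ->
  [/\ measurable E, T @^-1` E = E & mu E = 0%E].
Proof.
move=> g_lt0; split => //.
have [//|E1] := T_ergodic mE TE.
  have := birkhoff_unbounded_integral_ge0; rewrite leNgt => /negP[].
  suff -> : (\int[mu]_(x in E) (g x)%:E = \int[mu]_x (g x)%:E)%E by [].
  have mC : measurable (~` E) by exact: measurableC.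
  have C0 : mu (~` E) = 0%E by rewrite probability_setC// E1 subee.
  by rewrite [RHS](negligible_integral mC measurableT g_int C0) setTD setCK.
Qed.

Lemma birkhoff_unboundedP x : ~ birkhoff_unbounded x ->
  exists A, forall n, birkhoff_sum g n x <= A.
Proof.
move=> /existsNP[A /forallNP hA]; exists A%:R => n.
apply: le_trans (birkhoff_sum_le_max g n x) _.
by rewrite leNgt; apply/negP.
Qed.

End bounded.

(* The exceptional sets are invariant, so a measure lam that vanishes on the
   invariant null sets of mu need not be dominated by mu. *)
Theorem birkhoff_ergodic (lam : {measure set X -> \bar R}) (f : X -> R) (m : R) :
  (forall E, measurable E -> T @^-1` E = E -> mu E = 0%E -> lam E = 0%E) ->
  mu.-integrable setT (EFin \o f) -> (\int[mu]_x (f x)%:E = m%:E)%E ->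
  {ae lam, forall x, (fun n => n%:R^-1 * birkhoff_sum f n x) @ \oo --> m}.
Proof.
move=> mu_lam fi fm.
have bnd g : mu.-integrable setT (EFin \o g) -> (\int[mu]_x (g x)%:E < 0)%E ->
    {ae lam, forall x, exists A, forall n, birkhoff_sum g n x <= A}.
  move=> gi g0; have [mE TE E0] := birkhoff_unbounded_null gi g0.
  exists (birkhoff_unbounded g); split => //; first exact: mu_lam.
  by move=> x /= h; apply: contrapT => /birkhoff_unboundedP.
have cst_int (c : R) : mu.-integrable setT (EFin \o cst c).
  exact: finite_measure_integrable_cst.
have cstI (c : R) : (\int[mu]_x c%:E = c%:E)%E.
  have := integral_cst mu measurableT c%:E.
  by rewrite [X in (_ * X)%E]probability_setT mule1.
have up k : {ae lam, forall x, exists A, forall n,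
    birkhoff_sum (fun x => f x - (m + k.+1%:R^-1)) n x <= A}.
  apply: bnd; first exact: (integrableB measurableT fi (cst_int _)).
  rewrite (integralB_EFin measurableT fi (cst_int _)) fm/= cstI -EFinB lte_fin.
  by rewrite opprD addrA subrr sub0r oppr_lt0.
have dn k : {ae lam, forall x, exists A, forall n,
    birkhoff_sum (fun x => (m - k.+1%:R^-1) - f x) n x <= A}.
  apply: bnd; first exact: (integrableB measurableT (cst_int _) fi).
  rewrite (integralB_EFin measurableT (cst_int _) fi) fm/= cstI -EFinB lte_fin.
  by rewrite addrAC subrr sub0r oppr_lt0.
have sumB g h n x : birkhoff_sum (fun y => g y - h y) n x =
    birkhoff_sum g n x - birkhoff_sum h n x.
  by rewrite /birkhoff_sum sumrB.
have sumc c n x : birkhoff_sum (fun=> c) n x = n%:R * c.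
  by rewrite /birkhoff_sum sumr_const card_ord mulr_natl.
move/ae_foralln : up; move/ae_foralln : dn; apply: filterS2 => x dn up.
apply/cvgrPdist_le => e e0.
have [k ke] : exists k, k.+1%:R^-1 < e / 2.
  by have [k _ /(_ k (leqnn k))] := near_infty_natSinv_lt (PosNum (divr_gt0 e0 (ltr0n R 2))); exists k.
have [A hA] := up k; have [B hB] := dn k.
near=> n.
have n0 : 0 < n%:R :> R by rewrite ltr0n; near: n; exact: nbhs_infty_gt.
have := hA n; have := hB n; rewrite !sumB !sumc => hB' hA'.
have nA : A <= n%:R * (e / 2).
  rewrite -ler_pdivrMr ?divr_gt0//; near: n; exact: nbhs_infty_ger.
have nB : B <= n%:R * (e / 2).
  rewrite -ler_pdivrMr ?divr_gt0//; near: n; exact: nbhs_infty_ger.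
set q := n%:R^-1 * birkhoff_sum f n x.
have qE : birkhoff_sum f n x = n%:R * q by rewrite /q mulrA divff ?mul1r ?gt_eqF.
rewrite qE in hA' hB'.
have nk : n%:R * k.+1%:R^-1 <= n%:R * (e / 2) by rewrite ler_pM2l// ltW.
move: n0 nA nB nk hA' hB'; rewrite -/q.
move: (n%:R : R) (k.+1%:R^-1 : R) q {qE} => w c q w0 wA wB wc h1 h2.
have q1 : q <= m + e by rewrite -(ler_pM2l w0); lra.
have q2 : m - e <= q by rewrite -(ler_pM2l w0); lra.
by rewrite ler_norml; lra.
Unshelve. all: by end_near. Qed.

End birkhoff.

(** * Ergodicity and comparison with Lebesgue measure *)

Section zero_one_law.
Context (R : realType) (N : nat).
Hypothesis N_gt0 : (0 < N)%N.
Local Notation T := (@TN R N).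
Local Notation leb := (@lebesgue_measure R).
Local Notation D := (@regular_points R N).

Lemma preimage_iter E n : T @^-1` E = E -> iter n T @^-1` E = E.
Proof.
move=> TE; elim: n => //= n IH.
by rewrite -[LHS]/(iter n T @^-1` (T @^-1` E)) TE IH.
Qed.

(* An invariant set fills the same proportion, up to a constant, of every
   cylinder, hence has no density point in its complement. *)
Lemma TN_zero_one E : measurable E -> T @^-1` E = E -> leb (D `&` E) != 0%E ->
  leb (D `\` E) = 0%E.
Proof.
move=> mE TE B0; set B := D `&` E in B0.
have mD : measurable D by exact: measurable_regular.
have mB : measurable B by exact: measurableI.
have B_le1 : (leb B <= 1)%E.
  rewrite -(lebesgue_regular R N_gt0) le_measure ?inE//; exact: subIsetl.
have B_fin : leb B \is a fin_num by rewrite ge0_fin_numE ?(le_lt_trans B_le1) ?ltry.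
pose beta := fine (leb B); have betaE : leb B = beta%:E by rewrite fineK.
have beta0 : 0 < beta by rewrite -lte_fin -betaE lt0e B0/=.
have [A [mA A0 hA]] := lebesgue_density mB.
apply: (@subset_measure0 _ _ _ leb _ A) => //; first exact: measurableD.
move=> x [Dx Ex]; apply: hA => /= xlim.
have nBx : ~ B x by case.
have beta512 : 0 < beta / 512 by lra.
rewrite indicE memNset// mulr0n in xlim.
have : \forall r \near 0^'+, (leb (B `&` ball x r) * (leb (ball x r))^-1 < (beta / 512)%:E)%E.
  apply: (xlim [set y | y < (beta / 512)%:E]%E); apply: open_ereal_lt'.
  by rewrite lte_fin.
move=> [/= d d0 hd].
pose n := Num.truncn (8 / d).
have J := jac_gt0 N_gt0 (regular_orbit_in (n := n) Dx).
have nd : 4 / jac N n x < d.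
  have := jac_ge N_gt0 (regular_orbit_in (n := n) Dx).
  have := truncnS_gt (8 / d); rewrite -/n ltr_pdivrMr// ltr_pdivrMr// => h1 h2.
  have : n.+1%:R * d <= 2 * jac N n x * d by rewrite ler_pM2r.
  lra.
set r := 4 / jac N n x in nd.
have r0 : 0 < r by rewrite divr_gt0.
have := hd r; rewrite /= sub0r normrN gtr0_norm// => /(_ nd r0).
rewrite lebesgue_measure_ball ?ltW// inver.
rewrite mulrn_eq0/= gt_eqF//; apply/negP; rewrite -leNgt.
rewrite lee_pdivlMr ?mulrn_wgt0//.
have h : (leb B <= (64 * jac N n x)%:E * leb (B `&` ball x r))%E.
  apply: (@lebesgue_le_expanding R _ _ (branch N n x)); first by rewrite mulr_gt0.
  - move=> b [Db Eb].
    have [ob bx Eb'] := branchP N_gt0 (regular_orbit_in (n := n) Dx) (Db 0%N).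
    split; last by rewrite /ball/=; exact: branch_close (Db 0%N).
    split; first exact: regular_branch.
    by rewrite -(preimage_iter n TE) /= Eb'.
  - move=> b c [Db _] [Dc _].
    exact: (branch_expanding N_gt0 (regular_orbit_in (n := n) Dx) (Db 0%N) (Dc 0%N)).
rewrite betaE -lee_pdivrMl ?mulr_gt0// in h; apply: le_trans h.
rewrite -!EFinM lee_fin le_eqVlt; apply/orP; left; apply/eqP; rewrite /r -mulr_natr; field.
by rewrite gt_eqF.
Qed.

End zero_one_law.

Lemma measure_fibers d (X : measurableType d) (R : realType)
    (mu : {measure set X -> \bar R}) (f : X -> nat) (A : set X) :
  measurable_fun setT f -> measurable A ->
  mu A = (\sum_(j <oo) mu (A `&` f @^-1` [set j]))%E.
Proof.
move=> mf mA.
have mF j : measurable (A `&` f @^-1` [set j]).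
  by apply: measurableI => //; rewrite -[X in measurable X]setTI; exact: mf.
have := @measure_bigcup _ _ _ mu setT (fun j => A `&` f @^-1` [set j]) (fun j _ => mF j).
rewrite -setI_bigcupr.
have -> : \bigcup_j (f @^-1` [set j]) = setT by apply/seteqP; split => // x _; exists (f x).
rewrite setIT => ->.
  by apply: eq_eseriesl => j; rewrite in_setT.
by move=> i j _ _ [x [[_ /= <-] [_ /= <-]]].
Qed.

Section comparability.
Context (R : realType) (N : nat).
Hypothesis N_gt0 : (0 < N)%N.
Local Notation T := (@TN R N).
Local Notation a1 := (fun x : R => Num.truncn (N%:R / x)).
Local Notation leb := (@lebesgue_measure R).
Local Notation D := (@regular_points R N).

Definition digits n x : seq nat := [seq a1 (iter i T x) | i <- iota 0 n].
Arguments digits : simpl never.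

Lemma digitsS n x : digits n.+1 x = a1 x :: digits n (T x).
Proof.
rewrite /digits /= -[1%N]add1n iotaDl -map_comp; congr cons.
by apply: eq_map => i /=; rewrite -iterSr.
Qed.

Lemma digits_same n x y : digits n x = digits n y -> same_digits N n x y.
Proof.
move=> xy i ni; have := congr1 (fun s => nth 0%N s i) xy.
by rewrite !(nth_map 0%N) ?size_iota// nth_iota// add0n.
Qed.

Lemma digits_branch n x b : regular_points N x -> 0 < b < 1 ->
  digits n (branch N n x b) = digits n x.
Proof.
move=> Dx b01.
have [_ bx _] := branchP N_gt0 (regular_orbit_in (n := n) Dx) b01.
by apply/eq_in_map => i; rewrite mem_iota add0n => /bx.
Qed.

Lemma measurable_digits n : measurable_fun [set: R] (fun x => pickle (digits n x)).
Proof.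
apply: measurable_fun_nat => j.
have H w : measurable [set x | digits n x = w].
  elim: n w => [|n IH] [|a w].
  - rewrite (_ : [set x | _] = setT)//; exact/seteqP.
  - by rewrite (_ : [set x | _] = set0)//; apply/seteqP; split => x.
  - by rewrite (_ : [set x | _] = set0)//; apply/seteqP; split => x.
  - rewrite (_ : [set x | _] = a1 @^-1` [set a] `&` T @^-1` [set x | digits n x = w]).
      apply: measurableI; rewrite -[X in measurable X]setTI.
        exact: measurable_first_digit.
      exact: measurable_TN.
    by apply/seteqP; split => x /=; rewrite digitsS; [case=> -> ->|case=> <- <-].
have [[w <-]|ww] := pselect (exists w : seq nat, pickle w = j); last first.
  rewrite (_ : _ @^-1` _ = set0)//; apply/seteqP; split => x //= jE.
  by apply: ww; exists (digits n x).
have := H w; congr measurable; apply/seteqP; split => x /= [].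
  by move=> ->.
exact: (pcan_inj pickleK).
Qed.

Let mD : measurable D. Proof. exact: measurable_regular. Qed.

Definition cylinder n j := D `&` (fun x => pickle (digits n x)) @^-1` [set j].

Let measurable_cylinder n j : measurable (cylinder n j).
Proof.
apply: measurableI => //; rewrite -[X in measurable X]setTI.
exact: measurable_digits.
Qed.

Definition TN_pullback n B := D `&` iter n T @^-1` B.

Lemma measurable_TN_pullback n B : measurable B -> measurable (TN_pullback n B).
Proof.
move=> mB; apply: measurableI => //; rewrite -[X in measurable X]setTI.
by apply: measurable_iter => //; exact: measurable_TN.
Qed.

Lemma cylinder_same n j x y : cylinder n j x -> cylinder n j y ->
  same_digits N n x y.
Proof.
by move=> [_ /= <-] [_ /= /(pcan_inj pickleK) yx]; apply: digits_same.
Qed.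

Lemma pullback_cylinder_le n j x B : cylinder n j x -> B `<=` D ->
  (leb (TN_pullback n B `&` cylinder n j) <= (64 / jac N n x)%:E * leb B)%E /\
  (leb B <= (64 * jac N n x)%:E * leb (TN_pullback n B `&` cylinder n j))%E.
Proof.
move=> cx BD; have [Dx _] := cx.
have J := jac_gt0 N_gt0 (regular_orbit_in (n := n) Dx).
split.
- apply: (@lebesgue_le_expanding _ _ _ (iter n T)); first by rewrite divr_gt0.
    by move=> y [[_ ]].
  move=> y z [[Dy _] cy] [[Dz _] cz].
  apply: iter_TN_contracting => //; try exact: regular_orbit_in.
  + exact: cylinder_same cy cx.
  + exact: cylinder_same cz cx.
- apply: (@lebesgue_le_expanding _ _ _ (branch N n x)); first by rewrite mulr_gt0.
  + move=> b Bb; have Db := BD _ Bb.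
    have [_ _ Eb] := branchP N_gt0 (regular_orbit_in (n := n) Dx) (Db 0%N).
    have Dg := regular_branch N_gt0 n Dx Db.
    split; first by split => //=; rewrite Eb.
    split => //=; rewrite digits_branch//; last exact: (Db 0%N).
    by case: cx.
  + move=> b c Bb Bc.
    exact: (branch_expanding N_gt0 (regular_orbit_in (n := n) Dx) (BD _ Bb 0%N) (BD _ Bc 0%N)).
Qed.

(* 4096 is the square of the distortion constant 64. *)
Lemma lebesgue_pullback n B : measurable B -> B `<=` D ->
  (leb (TN_pullback n B) <= 4096%:E * leb B)%E /\
  (leb B <= 4096%:E * leb (TN_pullback n B))%E.
Proof.
move=> mB BD.
have mS := measurable_TN_pullback n mB.
have D1 : leb D = 1%E by exact: lebesgue_regular.
have TD : TN_pullback n D = D.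
  by apply/seteqP; split => x; [case|move=> Dx; split => //=; exact: regular_iter].
have fin A : measurable A -> A `<=` D -> leb A \is a fin_num.
  move=> mA AD; rewrite ge0_fin_numE//; apply: (@le_lt_trans _ _ 1%E); last exact: ltry.
  by rewrite -D1 le_measure ?inE.
have SD A : TN_pullback n A `<=` D by apply: subIsetl.
have piece j : (leb (TN_pullback n B `&` cylinder n j) <= 4096%:E * leb B * leb (cylinder n j))%E /\
    (leb B * leb (cylinder n j) <= 4096%:E * leb (TN_pullback n B `&` cylinder n j))%E.
  have [->|/set0P[x cx]] := eqVneq (cylinder n j) set0.
    by rewrite setI0 !measure0 !mule0.
  have [Dx _] := cx; have J := jac_gt0 N_gt0 (regular_orbit_in (n := n) Dx).
  have [h1 h2] := pullback_cylinder_le cx BD.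
  have [h3 h4] := pullback_cylinder_le cx (@subset_refl _ D).
  rewrite TD in h3 h4; have cD : D `&` cylinder n j = cylinder n j.
    by apply: setIidr; exact: subIsetl.
  rewrite cD D1 in h3 h4.
  have fC : leb (cylinder n j) \is a fin_num by apply: fin => //; exact: subIsetl.
  have fB : leb B \is a fin_num by exact: fin.
  have fS : leb (TN_pullback n B `&` cylinder n j) \is a fin_num.
    apply: fin; first exact: measurableI.
    exact: subset_trans (@subIsetr _ _ _) (@subIsetl _ _ _).
  move: h1 h2 h3 h4.
  rewrite -(fineK fC) -(fineK fB) -(fineK fS) -!EFinM !lee_fin.
  set s := fine (leb (TN_pullback n B `&` cylinder n j)).
  set c := fine (leb (cylinder n j)); set b := fine (leb B) => h1 h2 h3 h4.
  have s0 : 0 <= s by exact: fine_ge0.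
  have c0 : 0 <= c by exact: fine_ge0.
  have b0 : 0 <= b by exact: fine_ge0.
  rewrite mulr1 in h3; rewrite mulrAC ler_pdivlMr// in h1.
  rewrite ler_pdivlMr// in h3.
  split.
  - rewrite -(ler_pM2r J); apply: (le_trans h1).
    by have : 64 * b * 1 <= 64 * b * (64 * jac N n x * c); [rewrite ler_wpM2l// mulr_ge0|lra].
  - apply: (@le_trans _ _ (64 * jac N n x * s * c)); first by rewrite ler_wpM2r.
    by have : 64 * s * (c * jac N n x) <= 64 * s * 64; [rewrite ler_wpM2l// mulr_ge0|lra].
have cS : leb (TN_pullback n B) = (\sum_(j <oo) leb (TN_pullback n B `&` cylinder n j))%E.
  rewrite (measure_fibers leb (measurable_digits n) mS).
  apply: eq_eseriesr => j _; congr (leb _); rewrite /cylinder setIA.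
  by congr (_ `&` _); apply/esym/setIidl.
have cD : (\sum_(j <oo) leb (cylinder n j) = 1)%E.
  by rewrite -D1 (measure_fibers leb (measurable_digits n) mD).
have B0 : (0 <= leb B)%E by exact: measure_ge0.
have fB : leb B \is a fin_num by exact: fin.
split.
- have -> : (4096%:E * leb B = \sum_(j <oo) (4096%:E * leb B * leb (cylinder n j)))%E.
    by rewrite -(fineK fB) -EFinM nneseriesZl ?cD ?mule1.
  by rewrite cS; apply: lee_nneseries => // j _; have [] := piece j.
- have -> : (leb B = \sum_(j <oo) (leb B * leb (cylinder n j)))%E.
    by rewrite -(fineK fB) nneseriesZl ?cD ?mule1.
  rewrite cS -nneseriesZl//; apply: lee_nneseries; last by move=> j _; have [] := piece j.
  by move=> *; apply: mule_ge0; exact: measure_ge0.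
Qed.

End comparability.

Section acip.
Context (R : realType) (N : nat) (mu : probability (measurableTypeR R) R).
Hypothesis N_gt0 : (0 < N)%N.
Hypothesis mu_acip : is_acip N mu.
Local Notation T := (@TN R N).
Local Notation leb := (@lebesgue_measure R).
Local Notation D := (@regular_points R N).

Let mD : measurable D. Proof. exact: measurable_regular. Qed.

Lemma acip_mp : measure_preserving mu T. Proof. by case: mu_acip. Qed.

Lemma acip_null A : measurable A -> leb A = 0%E -> mu A = 0%E.
Proof. by case: mu_acip => _ _ /null_content_dominatesP; exact. Qed.

Lemma acip_regular : mu D = 1%E.
Proof.
have [_ mu01 _] := mu_acip.
have m01 : measurable (`[0, 1]%classic : set R) by exact: measurable_itv.
have D01 : D `<=` `[0, 1]%classic.
  by move=> x /(_ 0%N)/andP[x0 x1]; rewrite /= in_itv/= !ltW.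
have n0 : mu (`[0, 1]%classic `\` D) = 0%E.
  by apply: acip_null; [exact: measurableD|exact: lebesgue_nonregular].
rewrite -mu01 -[in RHS](setDUK D01) measureU//; last first.
- by apply/seteqP; split => x //= [? []].
- exact: measurableD.
by rewrite [X in _ = (_ + X)%E](_ : _ = 0%E) ?adde0.
Qed.

Lemma acip_setI_regular A : measurable A -> mu (D `&` A) = mu A.
Proof.
move=> mA; have mC : measurable (~` D) by exact: measurableC.
have nD : mu (~` D) = 0%E by rewrite probability_setC// acip_regular subee.
rewrite -[in RHS](setIT A) -(setUv D) setIUr measureU//; last first.
- by rewrite setIACA setICr setI0.
- exact: measurableI.
- exact: measurableI.
rewrite [X in (_ + X)%E](_ : _ = 0%E) ?adde0 1?setIC//.
by apply: (@subset_measure0 _ _ _ mu _ (~` D)) => //; exact: measurableI.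
Qed.

Lemma acip_ergodic_dichotomy E : measurable E -> T @^-1` E = E ->
  leb (D `&` E) = 0%E /\ mu E = 0%E \/ leb (D `\` E) = 0%E /\ mu E = 1%E.
Proof.
move=> mE TE; have [E0|E0] := eqVneq (leb (D `&` E)) 0%E.
  left; split => //; rewrite -acip_setI_regular//.
  by apply: acip_null => //; exact: measurableI.
right; have DE := TN_zero_one N_gt0 mE TE E0; split => //.
have mC : measurable (~` E) by exact: measurableC.
have : mu (~` E) = 0%E.
  rewrite -acip_setI_regular//; apply: acip_null; first exact: measurableI.
  by rewrite -setDE.
rewrite probability_setC// => /eqP; rewrite sube_eq ?add0e; first by move/eqP.
all: rewrite ?fin_num_measure//.
Qed.

Lemma acip_ergodic E : measurable E -> T @^-1` E = E -> mu E = 0%E \/ mu E = 1%E.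
Proof. by move=> mE TE; have [[_]|[_]] := acip_ergodic_dichotomy mE TE; [left|right]. Qed.

Lemma acip_birkhoff (f : R -> R) (m : R) :
  mu.-integrable setT (EFin \o f) -> (\int[mu]_x (f x)%:E = m%:E)%E ->
  {ae leb, forall x, D x ->
    (fun n => n%:R^-1 * birkhoff_sum T f n x) @ \oo --> m}.
Proof.
move=> fi fm.
have null E : measurable E -> T @^-1` E = E -> mu E = 0%E -> mrestr leb mD E = 0%E.
  move=> mE TE E0; have [[DE _]|[_]] := acip_ergodic_dichotomy mE TE.
    by rewrite /mrestr setIC.
  by rewrite E0 => /eqP; rewrite eqe eq_sym oner_eq0.
have [A [mA A0 hA]] := birkhoff_ergodic acip_mp acip_ergodic null fi fm.
exists (A `&` D); split => //; first exact: measurableI.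
by move=> x /= /not_implyP[Dx nx]; split => //; exact: hA.
Qed.

Let acip_comparable4096 B : measurable B -> B `<=` D ->
  (mu B <= 4096%:E * leb B)%E /\ (leb B <= 4096%:E * mu B)%E.
Proof.
move=> mB BD.
have fi : mu.-integrable setT (EFin \o \1_B).
  by apply: integrable_indic => //; rewrite ?fin_num_fun_lty// fin_num_measure.
have muB : mu B \is a fin_num by exact: fin_num_measure.
have fm : (\int[mu]_x (\1_B x)%:E = (fine (mu B))%:E)%E.
  by rewrite integral_indic// setIT fineK.
have leb_D : leb D = 1%E by exact: lebesgue_regular.
have leb_Dy : (leb D < +oo)%E by rewrite leb_D ltry.
pose F n x : R := n%:R^-1 * birkhoff_sum T \1_B n x.
have m1 i : measurable_fun D (fun x => (\1_B (iter i T x))%:E : \bar R).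
  apply/measurable_EFinP/measurable_funTS; apply: measurableT_comp; first exact: measurable_indic.
  by apply: measurable_iter; exact: measurable_TN.
have FE n x : (F n x)%:E = (n%:R^-1%:E * \sum_(i < n) (\1_B (iter i T x))%:E)%E.
  by rewrite sumEFin -EFinM.
have mF n : measurable_fun D (EFin \o F n).
  rewrite (_ : _ \o _ = fun x => (n%:R^-1%:E * \sum_(i < n) (\1_B (iter i T x))%:E)%E).
    by apply: measurable_funeM; exact: emeasurable_sum.
  by apply/funext => x; exact: FE.
have F01 n x : 0 <= F n x <= 1.
  have S0 : 0 <= (birkhoff_sum T \1_B n x : R) by rewrite /birkhoff_sum; apply: sumr_ge0 => i _; rewrite indicE.
  have Sn : (birkhoff_sum T \1_B n x : R) <= n%:R.
    rewrite /birkhoff_sum -[n in leRHS]card_ord -sum1_card natr_sum; apply: ler_sum => i _.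
    by rewrite indicE; case: (_ \in _).
  rewrite mulr_ge0//=; case: n S0 Sn => [|n] S0 Sn; first by rewrite /F invr0 mul0r.
  by rewrite /F mulrC ler_pdivrMr ?mul1r.
have [] := @dominated_convergence _ _ _ leb D mD (fun n => EFin \o F n)
  (cst (fine (mu B))%:E) (cst 1%E) mF (measurable_cst _).
- have [A [mA A0 hA]] := acip_birkhoff fi fm; exists A; split => // x /= nx.
  apply: hA => /= h; apply: nx => /h{}h.
  by apply: cvg_EFin; [exact: nearW|exact: h].
- apply/integrableP; split; first exact: measurable_cst.
  by rewrite integral_cst//= normr1 mul1e; exact: leb_Dy.
- apply: aeW => x n _; rewrite /= lee_fin; have /andP[F0 F1] := F01 n x.
  by rewrite ger0_norm.
move=> _ _; rewrite integral_cst// [X in (_ * X)%E]leb_D mule1 fineK// => cvgF.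
have IF n : (\int[leb]_(x in D) (F n x)%:E =
    n%:R^-1%:E * \sum_(i < n) leb (TN_pullback N i B))%E.
  under eq_integral do rewrite FE.
  have z i x : (0 <= (\1_B (iter i T x) : R)%:E)%E by rewrite lee_fin indicE.
  rewrite ge0_integralZl//.
  - rewrite (ge0_integral_sum leb mD (fun i : 'I_n => m1 i) (fun i x _ => z i x)); congr (_ * _)%E.
    apply: eq_bigr => i _.
    have mTB : measurable (iter i T @^-1` B).
      by rewrite -[X in measurable X]setTI; apply: measurable_iter => //; exact: measurable_TN.
    by have := integral_indic leb mD mTB; rewrite setIC => <-; apply: eq_integral.
  - by apply: (@emeasurable_sum _ _ _ D _ _ (fun (i : 'I_n) x => (\1_B (iter i T x))%:E)) => i; exact: m1.
  - by move=> x Dx; apply: sume_ge0 => i _; exact: z.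
have leb_B : leb B \is a fin_num.
  rewrite ge0_fin_numE//; apply: (@le_lt_trans _ _ 1%E); last exact: ltry.
  by rewrite -leb_D le_measure ?inE.
have scale (c : \bar R) n : (0 < n)%N -> c \is a fin_num ->
    (n%:R^-1%:E * \sum_(i < n) c = c)%E.
  move=> n0 /fineK <-; rewrite sumEFin sumr_const card_ord -EFinM -[X in _ * X]mulr_natl.
  by rewrite mulrA mulVf ?mul1r// pnatr_eq0 -lt0n.
have c4096 : (0 <= 4096%:E :> \bar R)%E by rewrite lee_fin ler0n.
split.
- rewrite -(cvg_lim _ cvgF)//; apply: lime_le; first by apply/cvg_ex; eexists; exact: cvgF.
  near=> n; rewrite /= IF; have n0 : (0 < n)%N by near: n; exact: nbhs_infty_gt.
  rewrite -(scale (4096%:E * leb B)%E n)//; last by rewrite fin_numM.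
  rewrite lee_pmul2l ?lte_fin ?invr_gt0 ?ltr0n//; apply: lee_sum => i _.
  by have [] := lebesgue_pullback N_gt0 i mB BD.
- have c0 : 0 < 4096 :> R by rewrite ltr0n.
  rewrite -lee_pdivrMl//.
  rewrite -(cvg_lim _ cvgF)//; apply: lime_ge; first by apply/cvg_ex; eexists; exact: cvgF.
  near=> n; rewrite /= IF; have n0 : (0 < n)%N by near: n; exact: nbhs_infty_gt.
  rewrite -(scale ((4096^-1)%:E * leb B)%E n)//; last by rewrite fin_numM.
  rewrite lee_pmul2l ?lte_fin ?invr_gt0 ?ltr0n//; apply: lee_sum => i _.
  by rewrite lee_pdivrMl//; have [] := lebesgue_pullback N_gt0 i mB BD.
Unshelve. all: by end_near. Qed.

Lemma acip_comparable : exists2 C : R, 0 < C & forall B, measurable B -> B `<=` D ->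
  (mu B <= C%:E * leb B)%E /\ (leb B <= C%:E * mu B)%E.
Proof. by exists 4096; [rewrite ltr0n|exact: acip_comparable4096]. Qed.

End acip.

Section log_integrable.
Context (R : realType) (N : nat) (mu : probability (measurableTypeR R) R).
Hypothesis N_gt0 : (0 < N)%N.
Hypothesis mu_acip : is_acip N mu.
Local Notation T := (@TN R N).
Local Notation leb := (@lebesgue_measure R).
Local Notation D := (@regular_points R N).

Let mD : measurable D. Proof. exact: measurable_regular. Qed.

Lemma acip_mass_near0 : exists2 C : R, 0 < C & forall k : nat,
  (mu (D `&` `]-oo, (2 ^- k : R)]%classic) <= (C / 2 ^+ k)%:E)%E.
Proof.
have [C C0 muC] := acip_comparable N_gt0 mu_acip; exists C => // k.
have mA : measurable (D `&` `]-oo, (2 ^- k : R)]%classic) by exact: measurableI.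
have [h _] := muC _ mA (@subIsetl _ _ _).
apply: (le_trans h); rewrite EFinM; apply: lee_wpmul2l.
  by rewrite lee_fin ltW.
have sub : D `&` `]-oo, (2 ^- k : R)]%classic `<=` `[0, (2 ^- k : R)]%classic.
  by move=> x [/(_ 0%N)/andP[x0 _]]; rewrite /= !in_itv/= => ->; rewrite ltW.
have : (leb (D `&` `]-oo, (2 ^- k : R)]%classic) <= leb `[0%R, (2 ^- k : R)]%classic)%E.
  exact: le_outer_measure.
move=> /le_trans; apply; rewrite lebesgue_measure_itv/= lte_fin invr_gt0 exprn_gt0//.
by rewrite oppr0 adde0.
Qed.

Lemma lnN_le_series x : 0 < x ->
  ((- ln x)%:E <= \sum_(k <oo) (\1_(`]-oo, (2 ^- k : R)]%classic) x)%:E)%E.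
Proof.
move=> x0; pose m := Num.truncn (- ln x).
apply: (@le_trans _ _ (\sum_(0 <= k < m.+1) (\1_(`]-oo, (2 ^- k : R)]%classic) x)%:E)%E);
  last first.
  by apply: nneseries_lim_ge => k _ _; rewrite lee_fin indicE.
have [lx|lx] := leP (- ln x) 0.
  apply: (@le_trans _ _ 0%E); first by rewrite lee_fin.
  by apply: sume_ge0 => k _; rewrite lee_fin indicE.
rewrite (eq_big_nat _ _ (F2 := fun=> 1%E)); last first.
  move=> k /=; rewrite ltnS => km; rewrite indicE mem_set//= in_itv/=.
  rewrite -[x]lnK ?posrE// -(opprK (ln x)) expRN lef_pV2 ?posrE ?expR_gt0 ?exprn_gt0//.
  apply: (@le_trans _ _ (expR k%:R)).
    rewrite -[k%:R]mulr1 expRM_natl lerXn2r ?nnegrE ?expR_ge0//.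
    by have := expR_ge1Dx (1 : R); lra.
  rewrite ler_expR; apply: (@le_trans _ _ m%:R); first by rewrite ler_nat.
  by have /andP[] := truncn_itv (ltW lx).
rewrite sumEFin sumr_const_nat subn0 lee_fin.
by rewrite ltW// truncnS_gt.
Qed.

Let h (x : R) := ln (N%:R / x).

Lemma acip_ln_integrable : mu.-integrable setT (EFin \o h).
Proof.
have mln : measurable_fun [set: R] (fun x : R => - ln x).
  by apply: measurable_funN; exact: measurable_ln.
have mh : measurable_fun [set: R] h.
  by apply: measurableT_comp; [exact: measurable_ln|exact: measurable_Ndiv].
have mC : measurable (~` D) by exact: measurableC.
have nD : mu (~` D) = 0%E by rewrite probability_setC// acip_regular// subee.
have mEh : measurable_fun setT (EFin \o h) by exact/measurable_EFinP.
have := @negligible_integrable _ _ _ mu setT (~` D) (EFin \o h) mC measurableT mEh nD.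
move=> [_]; apply.
rewrite setTD setCK.
have i1 : mu.-integrable D (EFin \o (fun x => - ln x)).
  apply/integrableP; split; first by apply/measurable_EFinP; exact: measurable_funTS.
  have m1 k : measurable_fun D (fun x => (\1_(`]-oo, (2 ^- k : R)]%classic) x)%:E : \bar R).
    by apply/measurable_EFinP; apply: measurable_indic.
  have z k x : D x -> (0 <= (\1_(`]-oo, (2 ^- k : R)]%classic) x : R)%:E)%E.
    by rewrite lee_fin indicE.
  apply: (@le_lt_trans _ _
    (\int[mu]_(x in D) \sum_(k <oo) (\1_(`]-oo, (2 ^- k : R)]%classic) x)%:E)%E).
    apply: ge0_le_integral => //.
    - by apply: measurableT_comp => //; apply/measurable_EFinP; exact: measurable_funTS.
    - by apply: ge0_emeasurable_sum => // k _; exact: m1.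
    - move=> x Dx /=; have /andP[x0 x1] := Dx 0%N.
      rewrite ger0_norm ?oppr_ge0 ?ln_le0 ?(ltW x1)//; exact: lnN_le_series.
  rewrite integral_nneseries//.
  have [C C0 muC] := acip_mass_near0.
  apply: (@le_lt_trans _ _ (\sum_(k <oo) ((2 * C) / (2 ^ k.+1)%:R)%:E)%E).
    apply: lee_nneseries => [k _ _|k _]; first by apply: integral_ge0 => x; exact: z.
    rewrite integral_indic// setIC; apply: (le_trans (muC k)).
    rewrite lee_fin natrX exprS le_eqVlt; apply/orP; left; apply/eqP; field.
    by rewrite expf_neq0.
  apply: le_lt_trans (epsilon_trick0 _ _) (ltry _).
  by rewrite mulr_ge0// ltW.
have i2 : mu.-integrable D (EFin \o cst (ln N%:R)).
  exact: (finite_measure_integrable_cst mu (ln N%:R) mD).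
have i3 : mu.-integrable D (fun x : R => ((ln N%:R)%:E + (- ln x)%:E)%E).
  exact: integrableD.
move: i3; apply: eq_integrable => // x; rewrite inE => /(_ 0%N)/andP[x0 _].
by rewrite /= -EFinD /h ln_div ?posrE// ltr0n.
Qed.

End log_integrable.

(** * Entropy of partitions *)

Lemma gibbs_inequality (R : realType) (W : finType) (p q : W -> R) :
  (forall w, 0 <= p w) -> \sum_w p w = 1 ->
  (forall w, 0 <= q w) -> \sum_w q w <= 1 -> (forall w, q w = 0 -> p w = 0) ->
  - \sum_w p w * ln (p w) <= - \sum_w p w * ln (q w).
Proof.
move=> p0 p1 q0 q1 pq; rewrite lerN2 -subr_le0 -sumrB.
apply: (@le_trans _ _ (\sum_w (q w - p w))); last by rewrite sumrB p1 subr_le0.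
apply: ler_sum => w _; have [pw|pw] := eqVneq (p w) 0.
  by rewrite pw !mul0r !subr0; exact: q0.
have {}pw : 0 < p w by rewrite lt0r pw p0.
have qw : 0 < q w.
  by rewrite lt0r q0 andbT; apply/eqP => /pq p_eq0; rewrite p_eq0 ltxx in pw.
rewrite -mulrBr -ln_div ?posrE//.
have qp : 0 < q w / p w by rewrite divr_gt0.
have h : ln (q w / p w) <= q w / p w - 1.
  have := @le_ln1Dx R (q w / p w - 1).
  by rewrite (_ : 1 + (q w / p w - 1) = q w / p w); [apply; lra|ring].
have -> : q w - p w = p w * (q w / p w - 1) by field; rewrite gt_eqF.
by rewrite ler_wpM2l// ltW.
Qed.

Lemma fekete_cvg (R : realType) (a : nat -> R) : (forall n, 0 <= a n) ->
  (forall m n, a (m + n)%N <= a m + a n) -> cvgn (fun n => n%:R^-1 * a n).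
Proof.
move=> a0 asub.
pose S := [set n.+1%:R^-1 * a n.+1 | n in setT].
have Sinf : has_inf S.
  split; first by exists (1%:R^-1 * a 1%N), 0%N.
  by exists 0 => _ [n _ <-]; rewrite mulr_ge0 ?invr_ge0.
have amul m q : a (q * m)%N <= a 0%N + q%:R * a m.
  elim: q => [|q IH]; first by rewrite mul0n mul0r addr0.
  rewrite mulSn; apply: (le_trans (asub _ _)); rewrite -natr1; move: IH; lra.
apply/cvg_ex; exists (inf S); apply/cvgrPdist_le => e e0.
have [_ [m _ <-]] := inf_adherent (divr_gt0 e0 (ltr0n R 2)) Sinf.
set b := _ * _ => bS.
pose C := a 0%N + (a 0%N + m.+1%:R * a 1%N).
near=> n; have n0 : 0 < n%:R :> R by rewrite ltr0n; near: n; exact: nbhs_infty_gt.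
have nC : C <= n%:R * (e / 2).
  rewrite -ler_pdivrMr ?divr_gt0//; near: n; exact: nbhs_infty_ger.
have lo : inf S <= n%:R^-1 * a n.
  apply: ge_inf; first by case: Sinf.
  exists n.-1 => //; rewrite prednK//; rewrite -(ltr0n R)//.
have hi : a n <= C + n%:R * b.
  rewrite [in a n](divn_eq n m.+1); apply: (le_trans (asub _ _)).
  have h1 := amul m.+1 (n %/ m.+1)%N.
  have h2 := amul 1%N (n %% m.+1)%N; rewrite muln1 in h2.
  have h3 : (n %% m.+1)%:R * a 1%N <= m.+1%:R * a 1%N.
    by rewrite ler_wpM2r// ler_nat ltnW// ltn_mod.
  have h4 : (n %/ m.+1)%:R * a m.+1 <= n%:R * b.
    rewrite /b mulrA ler_wpM2r// ler_pdivlMr// -natrM ler_nat.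
    by rewrite leq_trunc_div.
  rewrite /C; lra.
have hi' : n%:R^-1 * a n <= b + e / 2.
  by rewrite -(ler_pM2l n0) mulrA divff ?gt_eqF// mul1r; move: hi nC; lra.
by rewrite ler_norml; lra.
Unshelve. all: by end_near. Qed.

Section entropy_bounds.
Context d (X : measurableType d) (R : realType) (mu : probability X R) (T : X -> X).
Hypothesis T_mp : measure_preserving mu T.
Variables (k : nat) (A : 'I_k -> set X).
Hypothesis A_part : measurable_partition A.

Local Notation atom := (join_atom T A).
Local Notation mass w := (fine (mu (join_atom T A w))).

Lemma partition_label : exists lab : X -> 'I_k, forall i x, A i x <-> lab x = i.
Proof.
have [[cov triv _] _] := A_part.
have /choice[lab labP] : forall x, exists i, A i x.
  move=> x; have : cover setT A x by rewrite cov.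
  by move=> [i _ ?]; exists i.
exists lab => i x; split => [Ai|<-//].
by apply: (triv _ _ Logic.I Logic.I); exists x; split => //; exact: labP.
Qed.

Lemma join_atom_ex n x : exists w : {ffun 'I_n -> 'I_k}, atom w x.
Proof.
have [lab labP] := partition_label.
by exists [ffun i => lab (iter (nat_of_ord i) T x)] => i; rewrite ffunE; apply/labP.
Qed.

Lemma join_atom_inj n x (w w' : {ffun 'I_n -> 'I_k}) : atom w x -> atom w' x -> w = w'.
Proof.
have [lab labP] := partition_label.
by move=> aw aw'; apply/ffunP => i; have /labP <- := aw i; have /labP <- := aw' i.
Qed.

Lemma measurable_join_atom n (w : {ffun 'I_n -> 'I_k}) : measurable (atom w).
Proof.
have [_ mA] := A_part; have [mT _] := T_mp.
have -> : atom w = \bigcap_(i in [set: 'I_n]) (iter i T @^-1` A (w i)).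
  by apply/seteqP; split => x h i; [move=> _; exact: (h i)|exact: (h i Logic.I)].
apply: fin_bigcap_measurable => // i _; rewrite -[X in measurable X]setTI.
exact: measurable_iter.
Qed.

Lemma join_atom_mass_ge0 n (w : {ffun 'I_n -> 'I_k}) : 0 <= mass w.
Proof. exact: fine_ge0. Qed.

Let atom_sum n (c : {ffun 'I_n -> 'I_k} -> R) x := \sum_w c w * \1_(atom w) x.

Let atom_sumE n c (w : {ffun 'I_n -> 'I_k}) x : atom w x -> atom_sum c x = c w.
Proof.
move=> wx; rewrite /atom_sum (bigD1 w)//= big1 ?addr0.
  by rewrite indicE mem_set// mulr1.
move=> w' w'w; rewrite indicE memNset ?mulr0// => w'x.
by rewrite (join_atom_inj wx w'x) eqxx in w'w.
Qed.

Let indic_int n (w : {ffun 'I_n -> 'I_k}) c :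
  mu.-integrable setT (EFin \o (fun x => c * \1_(atom w) x)).
Proof.
have i1 : mu.-integrable setT (EFin \o \1_(atom w)).
  by apply: integrable_indic; exact: measurable_join_atom.
have := integrableZl measurableT c i1.
by apply: eq_integrable => // x _; rewrite /= EFinM.
Qed.

Let atom_sum_int n (c : {ffun 'I_n -> 'I_k} -> R) :
  mu.-integrable setT (EFin \o atom_sum c).
Proof.
have := @integrable_sum _ _ _ mu setT measurableT _ (index_enum _) xpredT
  (fun w => EFin \o (fun x => c w * \1_(atom w) x)) (fun w _ => indic_int w (c w)).
by apply: eq_integrable => // x _; rewrite /= /atom_sum -sumEFin.
Qed.

Let atom_sum_integral n (c : {ffun 'I_n -> 'I_k} -> R) :
  (\int[mu]_x (atom_sum c x)%:E = (\sum_w mass w * c w)%:E)%E.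
Proof.
rewrite /atom_sum; under eq_integral do rewrite -sumEFin.
rewrite integral_sum//; last by move=> w; exact: indic_int.
rewrite -sumEFin; apply: eq_bigr => w _.
have i1 := indic_int w 1.
have mw := measurable_join_atom w.
have mwfin : mu (atom w) \is a fin_num by exact: fin_num_measure.
have E1 : (\int[mu]_x (\1_(atom w) x)%:E = (mass w)%:E)%E.
  by rewrite integral_indic// setIT fineK.
under eq_integral do rewrite EFinM.
rewrite integralZl//; last first.
  by apply: eq_integrable i1 => // x _; rewrite /= mul1r.
by rewrite E1 -EFinM mulrC.
Qed.

Lemma sum_mass n : \sum_(w : {ffun 'I_n -> 'I_k}) mass w = 1.
Proof.
apply: EFin_inj; have := @atom_sum_integral n (fun=> 1).
under [in RHS]eq_bigr do rewrite mulr1.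
move=> <-; rewrite (eq_integral (cst 1%E)).
  by rewrite integral_cst// mul1e; exact: probability_setT.
move=> x _; have [w wx] := join_atom_ex n x.
by rewrite (atom_sumE (fun=> 1) wx).
Qed.

Lemma integral_le_atoms n (D : set X) (f : X -> R) (c : {ffun 'I_n -> 'I_k} -> R) :
  measurable D -> mu D = 1%E -> mu.-integrable setT (EFin \o f) ->
  (forall w x, D x -> atom w x -> 0 < mass w -> f x <= c w) ->
  (\int[mu]_x (f x)%:E <= (\sum_w mass w * c w)%:E)%E.
Proof.
move=> mD D1 fi fc.
pose Z := \bigcup_(w in [set w : {ffun 'I_n -> 'I_k} | mass w = 0]) atom w.
have mZ : measurable Z.
  by apply: fin_bigcup_measurable => // w _; exact: measurable_join_atom.
have Z0 : mu Z = 0%E.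
  rewrite measure_fin_bigcup; last 3 first.
  - exact: finite_finset.
  - by move=> w w' _ _ [x [wx w'x]]; exact: join_atom_inj wx w'x.
  - by move=> w _; exact: measurable_join_atom.
  apply: fsbig1 => w /= w0; rewrite -[LHS]fineK ?w0//.
  by apply: fin_num_measure; exact: measurable_join_atom.
pose N := ~` D `|` Z.
have mN : measurable N by apply: measurableU => //; exact: measurableC.
have CD0 : mu (~` D) = 0%E by rewrite probability_setC// D1 subee.
have N0 : mu N = 0%E.
  apply/negligibleP => //; apply: negligibleU; apply/negligibleP => //.
  exact: measurableC.
have si := atom_sum_int c.
rewrite -atom_sum_integral (negligible_integral mN measurableT fi N0).
rewrite (negligible_integral mN measurableT si N0).
have mTN : measurable (setT `\` N) by exact: measurableD.
apply: le_integral => //; [exact: integrableS fi|exact: integrableS si|].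
move=> x; rewrite inE => -[_ Nx]; rewrite lee_fin.
have [w wx] := join_atom_ex n x; rewrite (atom_sumE c wx).
apply: (fc _ _ _ wx); first by apply: contrapT => Dx; apply: Nx; left.
rewrite lt0r join_atom_mass_ge0 andbT; apply/eqP => w0.
by apply: Nx; right; exists w.
Qed.

Lemma join_entropy_ge0 n : 0 <= join_entropy mu T A n.
Proof.
rewrite oppr_ge0; apply: sumr_le0 => w _; apply: mulr_ge0_le0.
  exact: join_atom_mass_ge0.
apply: ln_le0; rewrite -lee_fin fineK; first exact: probability_le1 (measurable_join_atom w).
by apply: fin_num_measure; exact: measurable_join_atom.
Qed.

Lemma join_entropy_ge n (D : set X) (f : X -> R) :
  measurable D -> mu D = 1%E -> mu.-integrable setT (EFin \o f) ->
  (forall (w : {ffun 'I_n -> 'I_k}) x, D x -> atom w x -> mass w <= expR (- f x)) ->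
  (\int[mu]_x (f x)%:E <= (join_entropy mu T A n)%:E)%E.
Proof.
move=> mD D1 fi fw; rewrite /join_entropy -sumrN.
under eq_bigr do rewrite -mulrN.
apply: (integral_le_atoms mD D1 fi) => w x Dx wx w0.
have := fw _ _ Dx wx; rewrite -[leLHS]lnK ?posrE// ler_expR; lra.
Qed.

Lemma join_entropy_le n (D : set X) (f : X -> R) (q : {ffun 'I_n -> 'I_k} -> R) :
  measurable D -> mu D = 1%E -> mu.-integrable setT (EFin \o f) ->
  (forall w, 0 <= q w) -> \sum_w q w <= 1 ->
  (forall w x, D x -> atom w x -> 0 < mass w -> expR (- f x) <= q w) ->
  ((join_entropy mu T A n)%:E <= \int[mu]_x (f x)%:E)%E.
Proof.
move=> mD D1 fi q0 q1 fq.
have qp w : q w = 0 -> mass w = 0.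
  move=> qw; apply/eqP; rewrite eq_le join_atom_mass_ge0 andbT leNgt; apply/negP => w0.
  have [x [Dx wx]] : exists x, D x /\ atom w x.
    apply: contrapT => nx; have wD : atom w `<=` ~` D by move=> x wx Dx; apply: nx; exists x.
    have CD0 : mu (~` D) = 0%E by rewrite probability_setC// D1 subee.
    have := subset_measure0 (measurable_join_atom w) (measurableC mD) wD CD0.
    by move=> mw; rewrite mw ltxx in w0.
  by have := fq _ _ Dx wx w0; rewrite qw leNgt expR_gt0.
have G := gibbs_inequality (@join_atom_mass_ge0 n) (sum_mass n) q0 q1 qp.
have I := @integral_le_atoms n D (fun x => - f x) (fun w => ln (q w)) mD D1 _ _.
have {}I : (\int[mu]_x (- f x)%:E <= (\sum_(w : {ffun 'I_n -> 'I_k}) mass w * ln (q w))%:E)%E.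
  apply: I; first by have := integrableN fi; apply: eq_integrable.
  move=> w x Dx wx w0; have := fq _ _ Dx wx w0.
  have qw : 0 < q w.
    by rewrite lt0r q0 andbT; apply/eqP => /qp mw; rewrite mw ltxx in w0.
  by rewrite -[leRHS]lnK ?posrE// ler_expR.
apply: (@le_trans _ _ (- \sum_(w : {ffun 'I_n -> 'I_k}) mass w * ln (q w))%:E).
  by rewrite lee_fin.
have IN : (\int[mu]_x (- f x)%:E = - \int[mu]_x (f x)%:E)%E.
  by rewrite -[RHS](integralN (integrable_add_def measurableT fi)).
by rewrite EFinN leeNl -IN.
Qed.

(* Gibbs' inequality against the product of the two marginal distributions. *)
Lemma join_entropy_subadditive m n :
  join_entropy mu T A (m + n) <= join_entropy mu T A m + join_entropy mu T A n.
Proof.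
pose info j := @atom_sum j (fun w => - ln (mass w)).
have infoE j : (\int[mu]_x (info j x)%:E = (join_entropy mu T A j)%:E)%E.
  rewrite atom_sum_integral /join_entropy -sumrN; congr EFin.
  by apply: eq_bigr => w _; rewrite mulrN.
have infoI j : mu.-integrable setT (EFin \o info j) by exact: atom_sum_int.
have infoT := mp_iter_integrable T_mp m (infoI n).
have infoTE : (\int[mu]_x (info n (iter m T x))%:E = (join_entropy mu T A n)%:E)%E.
  by rewrite -infoE -[RHS](mp_iter_integral T_mp m (infoI n)).
pose lw (w : {ffun 'I_(m + n) -> 'I_k}) : {ffun 'I_m -> 'I_k} := [ffun j => w (lshift n j)].
pose rw (w : {ffun 'I_(m + n) -> 'I_k}) : {ffun 'I_n -> 'I_k} := [ffun j => w (rshift m j)].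
have lwx w x : atom w x -> atom (lw w) x.
  by move=> wx i; have := wx (lshift n i); rewrite ffunE.
have rwx w x : atom w x -> atom (rw w) (iter m T x).
  move=> wx i; have -> : iter i T (iter m T x) = iter (m + i) T x by rewrite addnC iterD.
  by rewrite ffunE; exact: (wx (rshift m i)).
have mass_le B (w : {ffun 'I_(m + n) -> 'I_k}) : measurable B -> atom w `<=` B -> mass w <= fine (mu B).
  move=> mB wB; apply: fine_le; [apply: fin_num_measure; exact: measurable_join_atom|exact: fin_num_measure|].
  by apply: le_measure; rewrite ?inE//; exact: measurable_join_atom.
have lw_gt0 w : 0 < mass w -> 0 < mass (lw w).
  move=> /lt_le_trans; apply; apply: mass_le; first exact: measurable_join_atom.
  by move=> x; exact: lwx.
have rw_gt0 w : 0 < mass w -> 0 < mass (rw w).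
  have mr := measurable_join_atom (rw w).
  move=> /lt_le_trans; apply; rewrite -(mp_iter_measure T_mp m mr).
  apply: mass_le; last by move=> x; exact: rwx.
  rewrite -[X in measurable X]setTI; apply: measurable_iter => //.
  by case: T_mp.
pose glue (uv : {ffun 'I_m -> 'I_k} * {ffun 'I_n -> 'I_k}) : {ffun 'I_(m + n) -> 'I_k} :=
  [ffun i : 'I_(m + n) => match fintype.split i with inl j => uv.1 j | inr j => uv.2 j end].
have lwK uv : lw (glue uv) = uv.1.
  by apply/ffunP => j; rewrite !ffunE (unsplitK (inl j)).
have rwK uv : rw (glue uv) = uv.2.
  by apply/ffunP => j; rewrite !ffunE (unsplitK (inr j)).
have glueK : cancel (fun w => (lw w, rw w)) glue.
  by move=> w; apply/ffunP => i; rewrite ffunE; case: splitP => j ij; rewrite !ffunE;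
    congr (w _); exact: val_inj.
rewrite -lee_fin EFinD -(infoE m) -infoTE -integralD//; last exact: infoI.
apply: (@join_entropy_le _ setT (fun x => info m x + info n (iter m T x))
  (fun w => mass (lw w) * mass (rw w))) => //.
- exact: probability_setT.
- exact: (integrableD measurableT (infoI m) infoT).
- by move=> w; rewrite mulr_ge0//; exact: join_atom_mass_ge0.
- rewrite (reindex glue)/=; last first.
    exists (fun w => (lw w, rw w)) => [uv _|w _]; last exact: glueK.
    by rewrite lwK rwK -surjective_pairing.
  under eq_bigr do rewrite lwK rwK.
  rewrite -(pair_bigA _ (fun u v => mass u * mass v))/=.
  by rewrite -big_distrlr/= !sum_mass mulr1.
- move=> w x _ wx w0.
  rewrite /info (atom_sumE _ (lwx _ _ wx)) (atom_sumE _ (rwx _ _ wx)).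
  by rewrite opprD !opprK expRD !lnK// posrE; [exact: rw_gt0|exact: lw_gt0].
Qed.

Lemma partition_entropy_cvg : cvgn (fun n => n%:R^-1 * join_entropy mu T A n).
Proof. exact: fekete_cvg join_entropy_ge0 join_entropy_subadditive. Qed.

Lemma partition_entropy_le (c h : R) :
  (forall n, join_entropy mu T A n <= c + n%:R * h) -> partition_entropy mu T A <= h.
Proof.
move=> H; apply/ler_addgt0Pr => e e0; apply: limr_le; first exact: partition_entropy_cvg.
near=> n; have n0 : 0 < n%:R :> R by rewrite ltr0n; near: n; exact: nbhs_infty_gt.
have cn : c <= n%:R * e by rewrite -ler_pdivrMr//; near: n; exact: nbhs_infty_ger.
by rewrite -(ler_pM2l n0) mulrA divff ?gt_eqF// mul1r; have := H n; lra.
Unshelve. all: by end_near. Qed.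

Lemma partition_entropy_ge (c h : R) :
  (forall n, n%:R * h - c <= join_entropy mu T A n) -> h <= partition_entropy mu T A.
Proof.
move=> H; apply/ler_addgt0Pr => e e0; rewrite -lerBlDr.
apply: limr_ge; first exact: partition_entropy_cvg.
near=> n; have n0 : 0 < n%:R :> R by rewrite ltr0n; near: n; exact: nbhs_infty_gt.
have cn : c <= n%:R * e by rewrite -ler_pdivrMr//; near: n; exact: nbhs_infty_ger.
by rewrite -(ler_pM2l n0) [leRHS]mulrA divff ?gt_eqF// mul1r; have := H n; lra.
Unshelve. all: by end_near. Qed.

End entropy_bounds.

(** * The entropy is the integral of the logarithmic slope *)

Lemma compact_separation (R : realType) (k : nat) (K : 'I_k -> set R) :
  (forall a, compact (K a)) -> (forall a b x, K a x -> K b x -> a = b) ->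
  exists2 r : R, 0 < r & forall a b x y, K a x -> K b y -> `|x - y| < r -> a = b.
Proof.
move=> cK dK.
have H : \forall r \near 0^'+, forall a b : 'I_k, forall x, K a x ->
    forall y, K b y -> `|x - y| < r -> a = b.
  apply: filter_forall => a; apply: filter_forall => b.
  have [->|ab] := eqVneq a b; first exact: nearW.
  have /compact_near_coveringP near_cov := cK a.
  apply: (near_cov _ (0^'+ : set_system R) (fun r x => forall y, K b y -> `|x - y| < r -> a = b)).
  move=> x Kx.
  have oKb : open (~` K b).
    by apply: closed_openC; apply: compact_closed; [exact: Rhausdorff|exact: cK].
  move: (oKb); rewrite openE => /(_ x).
  have nKx : (~` K b) x by move=> /(dK _ _ _ Kx) /eqP; rewrite (negbTE ab).
  move=> /(_ nKx)[e /= e0 He].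
  exists (ball x (e / 2), [set r | r < e / 2]) => /=.
    split; first by apply: nbhsx_ballx; rewrite divr_gt0.
    by apply: nbhs_right_lt; rewrite divr_gt0.
  move=> [x' r] [/= xx' re] y Ky x'y; exfalso.
  apply: (He y) Ky; rewrite /ball/= in xx' *.
  have -> : x - y = (x - x') + (x' - y) by lra.
  apply: (le_lt_trans (ler_normD _ _)); lra.
have [d /= d0 Hd] := H.
exists (d / 2); first by rewrite divr_gt0.
move=> a b x y Kx Ky xy; apply: (Hd (d / 2) _ _ a b x Kx y Ky xy).
  by rewrite /= sub0r normrN gtr0_norm ?divr_gt0//; lra.
by rewrite divr_gt0.
Qed.

Section upper_bound.
Context (R : realType) (N : nat) (mu : probability (measurableTypeR R) R).
Hypothesis N_gt0 : (0 < N)%N.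
Hypothesis mu_acip : is_acip N mu.
Local Notation T := (@TN R N).
Local Notation leb := (@lebesgue_measure R).
Local Notation D := (@regular_points R N).

Let mD : measurable D. Proof. exact: measurable_regular. Qed.

Definition log_slope (x : R) : R := 2 * ln (N%:R / x) - ln N%:R.

Lemma jac_exp n x : D x -> jac N n x = expR (birkhoff_sum T log_slope n x).
Proof.
move=> Dx; rewrite /jac /birkhoff_sum expR_sum; apply: eq_bigr => i _.
have /andP[x0 _] := Dx i; have N0 : 0 < N%:R :> R by rewrite ltr0n.
have Nx : 0 < N%:R / iter i T x by rewrite divr_gt0.
rewrite /log_slope expRB expRM_natl !lnK ?posrE//.
by field; rewrite !gt_eqF.
Qed.

Definition shadow n r x := [set y | D y /\ forall i, (i < n)%N -> `|iter i T y - iter i T x| < r].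

Lemma measurable_shadow n r x : measurable (shadow n r x).
Proof.
have -> : shadow n r x = D `&` \bigcap_(i in `I_n) (iter i T @^-1` ball (iter i T x) r).
  apply/seteqP; split => [y [Dy h]|y [Dy h]]; split => // i ni.
    by rewrite /ball/= distrC; exact: h.
  by rewrite distrC; exact: h.
apply: measurableI => //; apply: fin_bigcap_measurable => [|i _]; first exact: finite_II.
rewrite -[X in measurable X]setTI; apply: measurable_iter => //.
  exact: measurable_TN.
exact: measurable_ball.
Qed.

Lemma lebesgue_shadow n r x : D x -> 0 < r <= 2^-1 ->
  ((r / (64 * jac N n x))%:E <= leb (shadow n r x))%E.
Proof.
move=> Dx /andP[r0 r1]; have J := jac_gt0 N_gt0 (regular_orbit_in (n := n) Dx).
rewrite mulrC EFinM lee_pdivrMl ?mulr_gt0//.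
pose B := D `&` ball (iter n T x) r.
have mB : measurable B by apply: measurableI => //; exact: measurable_ball.
have leb_sh : (leb B <= (64 * jac N n x)%:E * leb (shadow n r x))%E.
  apply: (@lebesgue_le_expanding _ _ _ (branch N n x)); first by rewrite mulr_gt0.
    move=> b [Db xb].
    have [ob bx Eb] := branchP N_gt0 (regular_orbit_in (n := n) Dx) (Db 0%N).
    split; first exact: regular_branch.
    move=> i ni; apply: le_lt_trans (orbit_contract_iter N_gt0 (ltnW ni) ob _ bx) _.
      exact: regular_orbit_in.
    by rewrite Eb distrC.
  move=> b c [Db _] [Dc _].
  exact: (branch_expanding N_gt0 (regular_orbit_in (n := n) Dx) (Db 0%N) (Dc 0%N)).
apply: le_trans leb_sh.
have /andP[y0 y1] := Dx n; set y := iter n T x in y0 y1 B mB *.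
have [I [lI I01 IB]] : exists I : interval R, [/\ leb [set` I] = r%:E,
    [set` I] `<=` `[0, 1]%classic & [set` I] `<=` ball y r].
  have [y2|y2] := leP y 2^-1.
    exists `]y, y + r[; split.
    - rewrite lebesgue_measure_itv/= lte_fin ltrDl r0 -EFinB; congr EFin; lra.
    - by move=> z /=; rewrite !in_itv/= => /andP[? ?]; lra.
    - by move=> z /=; rewrite /ball/= in_itv/= => /andP[? ?]; rewrite ltr_norml; lra.
  exists `]y - r, y[; split.
  - rewrite lebesgue_measure_itv/= lte_fin gtrBl r0 -EFinB; congr EFin; lra.
  - by move=> z /=; rewrite !in_itv/= => /andP[? ?]; lra.
  - by move=> z /=; rewrite /ball/= in_itv/= => /andP[? ?]; rewrite ltr_norml; lra.
have mI : measurable [set` I] by exact: measurable_itv.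
rewrite -lI; apply: (@le_trans _ _ (leb (B `|` (`[0%R, 1%R]%classic `\` D)))).
  apply: le_measure; rewrite ?inE//; first by apply: measurableU => //; exact: measurableD.
  move=> z Iz; have [Dz|nDz] := pselect (D z); [left|right]; split => //; [exact: IB|exact: I01].
have Z0 : leb (`[0%R, 1%R]%classic `\` D) = 0%E by exact: lebesgue_nonregular.
have U2 : (leb (B `|` (`[0%R, 1%R]%classic `\` D)) <=
    leb B + leb (`[0%R, 1%R]%classic `\` D))%E by exact: outer_measureU2.
by rewrite Z0 adde0 in U2.
Qed.

End upper_bound.

Lemma measure_bigsetU_le d (X : measurableType d) (R : realType)
    (mu : {measure set X -> \bar R}) (I : Type) (s : seq I) (F : I -> set X) :
  (forall i, measurable (F i)) ->
  (mu (\big[setU/set0]_(i <- s) F i) <= \sum_(i <- s) mu (F i))%E.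
Proof.
move=> mF; elim: s => [|i s IH]; first by rewrite !big_nil measure0.
rewrite !big_cons; apply: le_trans (leeD2l _ IH).
by apply: measureU2 => //; exact: bigsetU_measurable.
Qed.

Section upper_bound.
Context (R : realType) (N : nat) (mu : probability (measurableTypeR R) R).
Hypothesis N_gt0 : (0 < N)%N.
Hypothesis mu_acip : is_acip N mu.
Local Notation T := (@TN R N).
Local Notation leb := (@lebesgue_measure R).
Local Notation D := (@regular_points R N).

Let mD : measurable D. Proof. exact: measurable_regular. Qed.

Variables (k : nat) (A : 'I_k -> set (measurableTypeR R)).
Hypothesis A_part : measurable_partition A.

Lemma partition_compact_approx (eta : R) : 0 < eta ->
  exists K : 'I_k -> set R, [/\ forall a, compact (K a), forall a, K a `<=` D `&` A a &
    (mu (~` \bigcup_a K a) <= eta%:E)%E].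
Proof.
move=> eta0; have [C C0 muC] := acip_comparable N_gt0 mu_acip.
have [_ mA] := A_part.
pose e := eta / (C * k.+1%:R).
have e0 : 0 < e by rewrite divr_gt0// mulr_gt0.
have mDA a : measurable (D `&` A a) by apply: measurableI => //; exact: mA.
have /choice[K KP] : forall a, exists V : set R,
    [/\ compact V, V `<=` D `&` A a & (leb ((D `&` A a) `\` V) < e%:E)%E].
  move=> a; apply: lebesgue_regularity_inner => //.
  apply: (@le_lt_trans _ _ 1%E); last exact: ltry.
  by rewrite -(lebesgue_regular R N_gt0); apply: le_outer_measure; exact: subIsetl.
have mK a : measurable (K a) by apply: compact_measurable; have [] := KP a.
exists K; split => [a|a|]; [by have [] := KP a|by have [] := KP a|].
have mKU : measurable (\bigcup_a K a).
  by apply: fin_bigcup_measurable => //; exact: finite_finset.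
have mP a : measurable ((D `&` A a) `\` K a) by exact: measurableD.
pose Z := \big[setU/set0]_(a < k) ((D `&` A a) `\` K a).
have mZ : measurable Z by exact: bigsetU_measurable.
have sub : D `&` ~` (\bigcup_a K a) `<=` Z.
  have [lab labP] := partition_label A_part.
  move=> x [Dx nKx]; rewrite /Z -bigcup_seq; exists (lab x) => /=.
    by rewrite mem_index_enum.
  split; first by split => //; apply/labP.
  by move=> Kx; apply: nKx; exists (lab x).
rewrite -(acip_setI_regular N_gt0 mu_acip); last exact: measurableC.
have mDK : measurable (D `&` ~` (\bigcup_a K a)) by apply: measurableI => //; exact: measurableC.
have h1 : (mu (D `&` ~` (\bigcup_a K a)) <= mu Z)%E.
  by apply: le_measure => //; rewrite inE.
apply: (le_trans h1).
have h2 : (mu Z <= \sum_(a < k) mu ((D `&` A a) `\` K a))%E by exact: measure_bigsetU_le.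
apply: (le_trans h2).
apply: (@le_trans _ _ (\sum_(a < k) (C * e)%:E)%E).
  apply: lee_sum => a _.
  have [le1 _] := muC _ (mP a) (fun x h => h.1.1).
  apply: (le_trans le1); rewrite EFinM lee_pmul2l ?lte_fin//; apply: ltW.
  by have [] := KP a.
rewrite sumEFin sumr_const card_ord lee_fin -mulr_natl /e.
have -> : C * (eta / (C * k.+1%:R)) = eta / k.+1%:R.
  by rewrite invfM mulrCA (mulrA C) divff ?gt_eqF// mul1r.
rewrite mulrCA; apply: ler_piMr; first exact: ltW.
by rewrite ler_pdivrMr ?ltr0n// mul1r ler_nat leqnSn.
Qed.

Lemma log_slope_integrable : mu.-integrable setT (EFin \o log_slope N).
Proof.
have i1 := acip_ln_integrable N_gt0 mu_acip.
have i2 : mu.-integrable setT (EFin \o cst (ln N%:R)) by exact: finite_measure_integrable_cst.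
have i3 : mu.-integrable setT (fun x => 2%:E * (ln (N%:R / x))%:E)%E by exact: integrableZl.
have : mu.-integrable setT (fun x => 2%:E * (ln (N%:R / x))%:E - (ln N%:R)%:E)%E.
  exact: integrableB.
by apply: eq_integrable => // x _; rewrite /= -EFinM -EFinB.
Qed.

Section coding.
Variables (K : 'I_k -> set R) (r s : R).
Hypothesis cK : forall a, compact (K a).
Hypothesis KA : forall a, K a `<=` A a.
Hypothesis r01 : 0 < r <= 2^-1.
Hypothesis K_sep : forall a b x y, K a x -> K b y -> `|x - y| < 2 * r -> a = b.
Hypothesis s0 : 0 < s.
Hypothesis k0 : (0 < k)%N.

Let U a := \bigcup_(z in K a) ball z r.

Let U_inj a b y : U a y -> U b y -> a = b.
Proof.
move=> [z Kz zy] [z' Kz' zy']; apply: (K_sep Kz Kz'); rewrite /ball/= in zy zy'.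
have -> : z - z' = (z - y) - (z' - y) by lra.
by apply: (le_lt_trans (ler_normB _ _)); lra.
Qed.

Let mU a : measurable (U a).
Proof.
by apply: open_measurable; apply: bigcup_open => z _; exact: ball_open.
Qed.

Let delta := (1 - expR (- s)) / k%:R.

Let delta_gt0 : 0 < delta.
Proof. by rewrite divr_gt0 ?ltr0n// subr_gt0 expR_lt1 oppr_lt0. Qed.

(* Probability of the label a at y: the label of the nearby compact piece, or,
   with probability 1 - exp (- s), a uniformly random one. *)
Let kappa a (y : R) : R := expR (- s) * \1_(U a) y + delta.

Let kappa_ge0 a y : 0 <= kappa a y.
Proof. by rewrite addr_ge0 ?(ltW delta_gt0)// mulr_ge0 ?expR_ge0// indicE. Qed.

Let sum_kappa y : \sum_a kappa a y <= 1.
Proof.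
rewrite big_split/= sumr_const card_ord -mulr_natr /delta divfK ?pnatr_eq0 -?lt0n//.
rewrite -mulr_sumr; suff : \sum_a \1_(U a) y <= 1 :> R.
  by move=> /(ler_wpM2l (expR_ge0 (- s))); lra.
have [[a Ua]|nU] := pselect (exists a, U a y).
  rewrite (bigD1 a)//= big1 ?addr0; first by rewrite indicE; case: (_ \in _).
  by move=> b ba; rewrite indicE memNset// => Ub; rewrite (U_inj Ua Ub) eqxx in ba.
by rewrite big1// => a _; rewrite indicE memNset// => Ua; apply: nU; exists a.
Qed.

Let path_kappa n (w : {ffun 'I_n -> 'I_k}) (y : R) : R :=
  \prod_(i < n) kappa (w i) (iter i T y).

Let path_ge0 n (w : {ffun 'I_n -> 'I_k}) y : 0 <= path_kappa w y.
Proof. by apply: prodr_ge0 => i _; exact: kappa_ge0. Qed.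

Let sum_path n y : \sum_(w : {ffun 'I_n -> 'I_k}) path_kappa w y <= 1.
Proof.
rewrite /path_kappa -(bigA_distr_bigA (fun (i : 'I_n) a => kappa a (iter i T y))).
apply: prodr_ile1 => i _; rewrite sum_kappa andbT.
by apply: sumr_ge0 => a _; exact: kappa_ge0.
Qed.

Let measurable_path n (w : {ffun 'I_n -> 'I_k}) :
  measurable_fun D (fun y => (path_kappa w y)%:E).
Proof.
apply/measurable_EFinP; apply: measurable_prod => i _; apply: measurable_funTS.
apply: measurableT_comp; last by apply: measurable_iter; exact: measurable_TN.
by apply: measurable_funD => //; apply: measurable_funM.
Qed.

Let code n (w : {ffun 'I_n -> 'I_k}) : \bar R := (\int[leb]_(y in D) (path_kappa w y)%:E)%E.

Let code_ge0 n (w : {ffun 'I_n -> 'I_k}) : (0 <= code w)%E.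
Proof. by apply: integral_ge0 => y _; rewrite lee_fin path_ge0. Qed.

Let sum_code n : (\sum_(w : {ffun 'I_n -> 'I_k}) code w <= 1)%E.
Proof.
rewrite /code -(ge0_integral_sum leb mD (@measurable_path n)); last first.
  by move=> w y _; rewrite lee_fin path_ge0.
rewrite -(lebesgue_regular R N_gt0) -[leRHS]mul1e -integral_cst//.
apply: ge0_le_integral => //.
- by move=> y _; apply: sume_ge0 => w _; rewrite lee_fin path_ge0.
- by apply: emeasurable_sum => w; exact: measurable_path.
- by move=> y _; rewrite sumEFin lee_fin sum_path.
Qed.

Let code_fin n (w : {ffun 'I_n -> 'I_k}) : code w \is a fin_num.
Proof.
rewrite ge0_fin_numE ?code_ge0//; apply: (@le_lt_trans _ _ 1%E); last exact: ltry.
apply: le_trans (sum_code n).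
by rewrite (bigD1 w)//= leeDl// sume_ge0.
Qed.

Let Kbad := ~` \bigcup_a K a.
Let chi x : R := s - ln delta * \1_Kbad x.

Lemma coding_lower n (w : {ffun 'I_n -> 'I_k}) x : D x -> join_atom T A w x ->
  expR (- (ln (64 / r) + birkhoff_sum T (fun y => log_slope N y + chi y) n x)) <=
  fine (code w).
Proof.
move=> Dx wx; have /andP[r0 r1] := r01.
have J := jac_gt0 N_gt0 (regular_orbit_in (n := n) Dx).
have msh := measurable_shadow N n r x.
have sh_path y : shadow N n r x y -> expR (- birkhoff_sum T chi n x) <= path_kappa w y.
  move=> [Dy yx]; rewrite /birkhoff_sum -sumrN expR_sum; apply: ler_prod => i _.
  rewrite expR_ge0/= /chi indicE; have [xK|xK] := pselect (Kbad (iter i T x)).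
    rewrite mem_set// mulr1 opprB expRB lnK ?posrE//.
    apply: (@le_trans _ _ delta); last by rewrite lerDr mulr_ge0 ?expR_ge0// indicE.
    by rewrite ler_pdivrMr ?expR_gt0// ler_peMr ?(ltW delta_gt0)// ltW// pexpR_gt1.
  rewrite memNset// mulr0 subr0.
  move/contrapT : xK => [a _ Ka].
  have wa : w i = a.
    have [lab labP] := partition_label A_part.
    have /labP <- := KA Ka; apply/esym/labP; exact: wx.
  rewrite /kappa indicE wa mem_set ?mulr1 ?lerDl ?(ltW delta_gt0)//.
  by exists (iter i T x) => //; rewrite /ball/= distrC; exact: yx.
have shD : shadow N n r x `<=` D by move=> y [].
have h1 : ((expR (- birkhoff_sum T chi n x))%:E * leb (shadow N n r x) <= code w)%E.
  rewrite -integral_cst//.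
  apply: (@le_trans _ _ (\int[leb]_(y in shadow N n r x) (path_kappa w y)%:E)%E).
    apply: ge0_le_integral => //.
    - by move=> y _; rewrite lee_fin expR_ge0.
    - by apply: measurable_funS (@measurable_path _ w).
  apply: ge0_subset_integral => //; first exact: measurable_path.
  by move=> y _; rewrite lee_fin path_ge0.
have h2 := lebesgue_shadow N_gt0 n Dx r01.
rewrite -lee_fin fineK//; apply: le_trans h1.
apply: (@le_trans _ _ ((expR (- birkhoff_sum T chi n x))%:E * (r / (64 * jac N n x))%:E)%E); last first.
  by rewrite lee_pmul2l// lte_fin expR_gt0.
rewrite -EFinM lee_fin le_eqVlt; apply/orP; left; apply/eqP.
rewrite (_ : birkhoff_sum T _ n x = birkhoff_sum T (log_slope N) n x + birkhoff_sum T chi n x); last first.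
  by rewrite /birkhoff_sum big_split.
rewrite (jac_exp N_gt0 n Dx) !opprD !expRD (expRN (ln _)) lnK ?posrE ?divr_gt0//.
rewrite (expRN (birkhoff_sum _ (log_slope N) _ _)).
have e0 := expR_gt0 (birkhoff_sum T (log_slope N) n x).
by field; rewrite !gt_eqF.
Qed.

Lemma coding_bound (h : R) n : (\int[mu]_x (log_slope N x)%:E = h%:E)%E ->
  join_entropy mu T A n <=
  ln (64 / r) + n%:R * (h + s - ln delta * fine (mu Kbad)).
Proof.
move=> hE.
have mKU : measurable (\bigcup_a K a).
  apply: fin_bigcup_measurable => [|a _]; first exact: finite_finset.
  exact: compact_measurable.
have mKb : measurable Kbad by exact: measurableC.
have i1 : mu.-integrable setT (EFin \o cst s) by exact: finite_measure_integrable_cst.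
have i2 : mu.-integrable setT (fun x => (ln delta)%:E * (\1_Kbad x)%:E)%E.
  by apply: integrableZl => //; exact: integrable_indic.
have i3 : mu.-integrable setT (fun x => s%:E - (ln delta)%:E * (\1_Kbad x)%:E)%E.
  exact: integrableB.
have ichi : mu.-integrable setT (EFin \o chi).
  by move: i3; apply: eq_integrable => // x _; rewrite /= -EFinM -EFinB.
have chiE : (\int[mu]_x (chi x)%:E = (s - ln delta * fine (mu Kbad))%:E)%E.
  rewrite (_ : (\int[mu]_x (chi x)%:E = \int[mu]_x (s%:E - (ln delta)%:E * (\1_Kbad x)%:E))%E).
    rewrite integralB//; have := integral_cst mu measurableT s%:E.
    rewrite [X in (_ * X)%E]probability_setT mule1 => ->.
    rewrite integralZl//; last exact: integrable_indic.
    rewrite integral_indic// setIT EFinB EFinM fineK//; exact: fin_num_measure.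
  by apply: eq_integral => x _; rewrite -EFinM -EFinB.
pose g y := log_slope N y + chi y.
have ig : mu.-integrable setT (EFin \o g).
  by have := integrableD measurableT log_slope_integrable ichi; apply: eq_integrable.
have gE : (\int[mu]_x (g x)%:E = (h + s - ln delta * fine (mu Kbad))%:E)%E.
  rewrite (_ : (\int[mu]_x (g x)%:E = \int[mu]_x ((log_slope N x)%:E + (chi x)%:E))%E)//.
  by rewrite integralD// ?hE ?chiE -?EFinD ?addrA//; exact: log_slope_integrable.
have mp := acip_mp mu_acip.
have [iS SE] := birkhoff_sum_integral mp n ig gE.
have ic : mu.-integrable setT (EFin \o cst (ln (64 / r))) by exact: finite_measure_integrable_cst.
have if_ : mu.-integrable setT (EFin \o (fun x => ln (64 / r) + birkhoff_sum T g n x)).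
  by have := integrableD measurableT ic iS; apply: eq_integrable.
have fE : (\int[mu]_x (ln (64 / r) + birkhoff_sum T g n x)%:E =
   (ln (64 / r) + n%:R * (h + s - ln delta * fine (mu Kbad)))%:E)%E.
  rewrite (_ : (\int[mu]_x _ = \int[mu]_x ((ln (64 / r))%:E + (birkhoff_sum T g n x)%:E))%E)//.
  rewrite integralD// SE; have := integral_cst mu measurableT (ln (64 / r))%:E.
  by rewrite [X in (_ * X)%E]probability_setT mule1 => ->.
rewrite -lee_fin -fE.
apply: (join_entropy_le mp A_part mD _ if_ (q := fun w => fine (code w))).
- exact: acip_regular.
- by move=> w; apply: fine_ge0.
- rewrite -lee_fin -sumEFin; apply: le_trans (sum_code n).
  by apply: lee_sum => w _; rewrite fineK.
- by move=> w x Dx wx _; exact: coding_lower.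
Qed.

End coding.

Lemma partition_entropy_le_slope (h : R) : (\int[mu]_x (log_slope N x)%:E = h%:E)%E ->
  partition_entropy mu T A <= h.
Proof.
move=> hE; apply/ler_addgt0Pr => e e0.
have k0 : (0 < k)%N.
  have [lab _] := partition_label A_part; exact: leq_ltn_trans (leq0n _) (ltn_ord (lab 0)).
pose s := e / 2; have s0 : 0 < s by rewrite divr_gt0.
pose t := - ln ((1 - expR (- s)) / k%:R).
have t0 : 0 <= t.
  rewrite oppr_ge0 ln_le0// ler_pdivrMr ?ltr0n// mul1r.
  apply: (@le_trans _ _ 1); last by rewrite ler1n.
  by have := expR_gt0 (- s); lra.
have eta0 : 0 < s / (t + 1) by rewrite divr_gt0//; lra.
have [K [cK KDA Kmu]] := partition_compact_approx eta0.
have KA a : K a `<=` A a by move=> x /KDA[].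
have [lab labP] := partition_label A_part.
have dK a b x : K a x -> K b x -> a = b by move=> /KA/labP <- /KA/labP <-.
have [r0 r00 r0P] := compact_separation cK dK.
pose r := Num.min (r0 / 2) 2^-1.
have r01 : 0 < r <= 2^-1 by rewrite lt_min divr_gt0// invr_gt0 ltr0n/= ge_min lexx orbT.
have sep a b x y : K a x -> K b y -> `|x - y| < 2 * r -> a = b.
  move=> Ka Kb xy; apply: r0P Ka Kb _; apply: (lt_le_trans xy).
  have : r <= r0 / 2 by rewrite ge_min lexx.
  lra.
apply: (partition_entropy_le (acip_mp mu_acip) A_part (c := ln (64 / r))) => n.
apply: (le_trans (coding_bound cK KA r01 sep s0 k0 n hE)).
rewrite lerD2l ler_wpM2l// -addrA lerD2l.
have b1 : fine (mu (~` \bigcup_a K a)) <= s / (t + 1).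
  rewrite -lee_fin fineK//; apply: fin_num_measure; apply: measurableC.
  apply: fin_bigcup_measurable => [|a _]; first exact: finite_finset.
  exact: compact_measurable.
rewrite -mulNr -/t; set b := fine _ in b1 *.
have : t * b <= s.
  apply: (@le_trans _ _ (t * (s / (t + 1)))); first by rewrite ler_wpM2l.
  by rewrite mulrA ler_pdivrMr; [nra|lra].
rewrite /s; lra.
Qed.

End upper_bound.

Section lower_bound.
Context (R : realType) (N : nat) (mu : probability (measurableTypeR R) R).
Hypothesis N_gt0 : (0 < N)%N.
Hypothesis mu_acip : is_acip N mu.
Local Notation T := (@TN R N).
Local Notation leb := (@lebesgue_measure R).
Local Notation D := (@regular_points R N).

Let mD : measurable D. Proof. exact: measurable_regular. Qed.

Variables M J : nat.
Hypothesis M_gt0 : (0 < M)%N.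

(* The integer part of M N / x refines the first digit, and determines x up to
   a factor 1 + 1/M. *)
Definition fine_digit (x : R) : nat := Num.truncn ((M * N)%:R / x).

Definition grid (j : 'I_J.+1) : set (measurableTypeR R) :=
  [set x : R | minn (fine_digit x) J = j].

Lemma measurable_fine_digit : measurable_fun [set: R] fine_digit.
Proof.
have m1 := @measurable_Ndiv R (M * N); have m2 := @measurable_truncn R.
exact: measurableT_comp m2 m1.
Qed.

Lemma grid_partition : measurable_partition grid.
Proof.
split; last first.
  move=> j; have := @measurable_fine_digit measurableT [set t | minn t J = j] Logic.I.
  by rewrite setTI.
split.
- apply/seteqP; split => // x _.
  have lt : (minn (fine_digit x) J < J.+1)%N by rewrite ltnS geq_minr.
  by exists (Ordinal lt).
- move=> i j _ _ [x [/= xi xj]]; apply: val_inj; by rewrite /= -xi -xj.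
- move=> j _; have jJ : (j <= J)%N by rewrite -ltnS.
  have MN0 : (M * N)%:R != 0 :> R by rewrite pnatr_eq0 -lt0n muln_gt0 M_gt0.
  exists ((M * N)%:R / (j : nat)%:R); rewrite /grid /fine_digit /=.
  have -> : (M * N)%:R / ((M * N)%:R / (j : nat)%:R) = (j : nat)%:R :> R.
    by rewrite invf_div mulrC divfK.
  by rewrite natrK; apply/minn_idPl.
Qed.

Lemma fine_digit_le (x y : R) : 0 < x < 1 -> 0 < y < 1 ->
  fine_digit x = fine_digit y -> y <= x * (1 + M%:R^-1).
Proof.
move=> /andP[x0 x1] /andP[y0 y1] xy.
have M0 : 0 < M%:R :> R by rewrite ltr0n.
have MN0 : 0 < (M * N)%:R :> R by rewrite ltr0n muln_gt0 M_gt0.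
set j := fine_digit y in xy.
have jM : M%:R <= j%:R :> R.
  rewrite ler_nat /j /fine_digit truncn_ge_nat ?divr_ge0 ?(ltW y0)//.
  rewrite ler_pdivlMr//; apply: (@le_trans _ _ M%:R).
    by rewrite ler_piMr ?ltW.
  by rewrite ler_nat leq_pmulr.
have hx : (M * N)%:R / x < j%:R + 1.
  by rewrite -xy natr1; exact: truncnS_gt.
have hy : j%:R <= (M * N)%:R / y.
  by have /andP[] := truncn_itv (divr_ge0 (ltW MN0) (ltW y0)).
rewrite ltr_pdivrMr// in hx; rewrite ler_pdivlMr// in hy.
have h : j%:R + 1 <= j%:R * (1 + M%:R^-1) :> R.
  by rewrite mulrDr mulr1 lerD2l ler_pdivlMr// mul1r.
have j0 : 0 < j%:R :> R by exact: lt_le_trans jM.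
rewrite -(ler_pM2l j0); apply: (le_trans hy); apply: ltW; apply: (lt_le_trans hx).
by rewrite mulrCA mulrC ler_pM2l.
Qed.

Lemma fine_digit_first (x y : R) : 0 < x < 1 -> 0 < y < 1 ->
  fine_digit x = fine_digit y -> Num.truncn (N%:R / x) = Num.truncn (N%:R / y).
Proof.
have M0 : 0 < M%:R :> R by rewrite ltr0n.
have H (u v : R) : 0 < u -> 0 < v -> fine_digit u = fine_digit v ->
    (Num.truncn (N%:R / u) <= Num.truncn (N%:R / v))%N.
  move=> u0 v0 uv; set a := Num.truncn (N%:R / u).
  have Nu : 0 <= N%:R / u :> R by rewrite divr_ge0 ?ler0n// ltW.
  have Nv : 0 <= N%:R / v :> R by rewrite divr_ge0 ?ler0n// ltW.
  have E w : (M * N)%:R / w = M%:R * (N%:R / w) :> R by rewrite natrM mulrA.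
  rewrite truncn_ge_nat// -(ler_pM2l M0) -E.
  have MNv : 0 <= (M * N)%:R / v :> R by rewrite E mulr_ge0 ?(ltW M0).
  have MNu : 0 <= (M * N)%:R / u :> R by rewrite E mulr_ge0 ?(ltW M0).
  rewrite -natrM -truncn_ge_nat// -/(fine_digit v) -uv truncn_ge_nat// natrM E ler_pM2l//.
  by have /andP[] := truncn_itv Nu.
move=> /andP[x0 _] /andP[y0 _] xy; apply/eqP; rewrite eqn_leq !H//.
Qed.

Variable C : R.
Hypothesis C_gt0 : 0 < C.
Hypothesis pullback_le : forall B, measurable B -> B `<=` D ->
  (leb (TN_pullback N 1 B) <= C%:E * leb B)%E.

Definition cell n x := [set y | D y /\
  forall i, (i < n)%N -> minn (fine_digit (iter i T y)) J = minn (fine_digit (iter i T x)) J].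

Definition grid_slope (x : R) : R :=
  if (fine_digit x < J)%N then log_slope N x - 2 * ln (1 + M%:R^-1) else - ln C.

Lemma measurable_cell n x : measurable (cell n x).
Proof.
have -> : cell n x = D `&` \bigcap_(i in `I_n) ((fine_digit \o iter i T) @^-1`
    [set t | minn t J = minn (fine_digit (iter i T x)) J]) by [].
apply: measurableI => //; apply: fin_bigcap_measurable => [|i _]; first exact: finite_II.
rewrite -[X in measurable X]setTI.
apply: (measurableT_comp measurable_fine_digit) => //.
by apply: measurable_iter; exact: measurable_TN.
Qed.

Lemma cellS n x y : cell n.+1 x y -> cell n (T x) (T y) /\
  minn (fine_digit y) J = minn (fine_digit x) J.
Proof.
move=> [Dy h]; split; last exact: (h 0%N).
by split; [exact: regular_TN|move=> i ni; rewrite -!iterSr; exact: h].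
Qed.

Lemma lebesgue_cell n x : D x ->
  (leb (cell n x) <= (expR (- birkhoff_sum T grid_slope n x))%:E)%E.
Proof.
elim: n x => [|n IH] x Dx.
  rewrite /birkhoff_sum big_ord0 oppr0 expR0 -(lebesgue_regular R N_gt0).
  by apply: le_outer_measure => y [].
have IHx := IH _ (regular_TN Dx).
rewrite birkhoff_sumS opprD expRD EFinM.
suff H : (leb (cell n.+1 x) <= (expR (- grid_slope x))%:E * leb (cell n (T x)))%E.
  by apply: (le_trans H); rewrite lee_pmul2l// lte_fin expR_gt0.
rewrite /grid_slope; case: ifPn => [xJ|xJ].
  apply: (@lebesgue_le_expanding _ _ _ T); first exact: expR_gt0.
    by move=> y /cellS[].
  move=> y z yc zc.
  have [_ py] := cellS yc; have [_ pz] := cellS zc.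
  have ty : fine_digit y = fine_digit x by move: py; lia.
  have tz : fine_digit z = fine_digit x by move: pz; lia.
  have [Dy _] := yc; have [Dz _] := zc.
  have yz : same_digits N 1 y z.
    by case=> // _; apply: fine_digit_first (Dy 0%N) (Dz 0%N) _; rewrite ty.
  rewrite (orbit_dist N_gt0 (regular_orbit_in (n := 1) Dy) (regular_orbit_in (n := 1) Dz) yz).
  rewrite big_ord1/= mulrC ler_wpM2r//.
  have yx := fine_digit_le (Dx 0%N) (Dy 0%N) (esym ty).
  have zx := fine_digit_le (Dx 0%N) (Dz 0%N) (esym tz).
  have /andP[x0 _] := Dx 0%N; have /andP[y0 _] := Dy 0%N; have /andP[z0 _] := Dz 0%N.
  rewrite /= in x0 y0 z0.
  have N0 : 0 < N%:R :> R by rewrite ltr0n.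
  have M0 : 0 < 1 + M%:R^-1 :> R by rewrite addr_gt0// invr_gt0 ltr0n.
  have -> : expR (- (log_slope N x - 2 * ln (1 + M%:R^-1))) = (x * (1 + M%:R^-1)) ^+ 2 / N%:R.
    rewrite opprB /log_slope opprB expRD expRB !expRM_natl !lnK ?posrE ?divr_gt0//.
    set c := 1 + M%:R^-1 in M0 *; move: c M0 => c _.
    by field; rewrite !gt_eqF.
  rewrite ler_pM2r ?invr_gt0// expr2; apply: ler_pM => //; exact: ltW.
rewrite opprK lnK ?posrE//.
have sub : cell n.+1 x `<=` TN_pullback N 1 (cell n (T x)).
  by move=> y yc; have [c1 _] := cellS yc; have [Dy _] := yc.
have le1 : (leb (cell n.+1 x) <= leb (TN_pullback N 1 (cell n (T x))))%E by exact: le_outer_measure.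
apply: (le_trans le1); apply: pullback_le; first exact: measurable_cell.
by move=> y [].
Qed.

Lemma measurable_log_slope : measurable_fun [set: R] (log_slope N).
Proof.
apply: measurable_funB => //; apply: measurable_funM => //.
by apply: measurableT_comp; [exact: measurable_ln|exact: measurable_Ndiv].
Qed.

Lemma measurable_grid_slope : measurable_fun [set: R] grid_slope.
Proof.
apply: measurable_fun_ifT => //.
- by apply: measurable_fun_ltn => //; exact: measurable_fine_digit.
- by apply: measurable_funB => //; exact: measurable_log_slope.
Qed.

Definition grid_bound (x : R) : R := `|log_slope N x| + (`|2 * ln (1 + M%:R^-1)| + `|ln C|).

Lemma grid_slope_bound x : `|grid_slope x| <= grid_bound x.
Proof.
rewrite /grid_slope /grid_bound; case: ifP => _.
  apply: (le_trans (ler_normB _ _)); have := normr_ge0 (ln C); lra.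
have := normr_ge0 (log_slope N x); have := normr_ge0 (2 * ln (1 + M%:R^-1) : R).
rewrite normrN; lra.
Qed.

Lemma grid_bound_integrable : mu.-integrable setT (EFin \o grid_bound).
Proof.
have i1 : mu.-integrable setT (EFin \o (fun x => `|log_slope N x|)).
  by apply: integrable_norm; exact: log_slope_integrable.
have i2 : mu.-integrable setT (EFin \o cst (`|2 * ln (1 + M%:R^-1)| + `|ln C|)).
  exact: finite_measure_integrable_cst.
by have := integrableD measurableT i1 i2; apply: eq_integrable.
Qed.

Lemma grid_slope_integrable : mu.-integrable setT (EFin \o grid_slope).
Proof.
apply: le_integrable grid_bound_integrable => //.
  by apply/measurable_EFinP; exact: measurable_grid_slope.
move=> x _ /=; rewrite lee_fin; apply: (le_trans (grid_slope_bound x)).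
exact: ler_norm.
Qed.

Lemma grid_entropy_ge (h : R) : (\int[mu]_x (grid_slope x)%:E = h%:E)%E ->
  h <= partition_entropy mu T grid.
Proof.
move=> hE; have mp := acip_mp mu_acip.
have [E E0 muE] := acip_comparable N_gt0 mu_acip.
apply: (partition_entropy_ge mp grid_partition (c := ln E)) => n.
have [iS SE] := birkhoff_sum_integral mp n grid_slope_integrable hE.
have ic : mu.-integrable setT (EFin \o cst (ln E)) by exact: finite_measure_integrable_cst.
have if_ : mu.-integrable setT (EFin \o (fun x => birkhoff_sum T grid_slope n x - ln E)).
  by have := integrableB measurableT iS ic; apply: eq_integrable.
have fE : (\int[mu]_x (birkhoff_sum T grid_slope n x - ln E)%:E = (n%:R * h - ln E)%:E)%E.
  rewrite (_ : (\int[mu]_x _ = \int[mu]_x ((birkhoff_sum T grid_slope n x)%:E - (ln E)%:E))%E)//.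
  rewrite integralB// SE; have := integral_cst mu measurableT (ln E)%:E.
  by rewrite [X in (_ * X)%E]probability_setT mule1 => ->.
rewrite -lee_fin -fE; apply: (join_entropy_ge mp grid_partition mD _ if_).
  exact: acip_regular.
move=> w x Dx wx.
have mA := measurable_join_atom mp grid_partition w.
rewrite opprB expRB lnK ?posrE// -expRN mulrC.
rewrite -lee_fin fineK; last exact: fin_num_measure.
rewrite -(acip_setI_regular N_gt0 mu_acip)// mulrC EFinM.
have mDA : measurable (D `&` join_atom T grid w) by exact: measurableI.
have [le1 _] := muE _ mDA (@subIsetl _ _ _).
apply: (le_trans le1); rewrite lee_pmul2l ?lte_fin//.
apply: le_trans (lebesgue_cell n Dx); apply: le_outer_measure => y [Dy wy].
split => // i ni; have := wx (Ordinal ni); have := wy (Ordinal ni).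
by rewrite /grid /= => -> ->.
Qed.

End lower_bound.

Section entropy_formula.
Context (R : realType) (N : nat) (mu : probability (measurableTypeR R) R).
Hypothesis N_gt0 : (0 < N)%N.
Hypothesis mu_acip : is_acip N mu.
Local Notation T := (@TN R N).
Local Notation leb := (@lebesgue_measure R).
Local Notation D := (@regular_points R N).

Let pullback_const : exists2 C : R, 0 < C & forall B, measurable B -> B `<=` D ->
  (leb (TN_pullback N 1 B) <= C%:E * leb B)%E.
Proof.
exists 4096; first by rewrite ltr0n.
by move=> B mB BD; have [] := lebesgue_pullback N_gt0 1 mB BD.
Qed.

Lemma KS_entropy_ge_slope (h : R) M : (0 < M)%N ->
  (\int[mu]_x (log_slope N x)%:E = h%:E)%E ->
  ((h - 2 * ln (1 + M%:R^-1))%:E <= KS_entropy mu T)%E.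
Proof.
move=> M0 hE; have [C C0 pullC] := pullback_const.
have i1 := log_slope_integrable N_gt0 mu_acip.
have i2 : mu.-integrable setT (EFin \o cst (2 * ln (1 + M%:R^-1) : R)).
  exact: finite_measure_integrable_cst.
have fE : (\int[mu]_x (log_slope N x - 2 * ln (1 + M%:R^-1))%:E =
    (h - 2 * ln (1 + M%:R^-1))%:E)%E.
  rewrite (_ : (\int[mu]_x _ = \int[mu]_x ((log_slope N x)%:E - (2 * ln (1 + M%:R^-1))%:E))%E)//.
  rewrite integralB// hE; have := integral_cst mu measurableT (2 * ln (1 + M%:R^-1) : R)%:E.
  by rewrite [X in (_ * X)%E]probability_setT mule1 => ->.
have mls := @measurable_log_slope R N.
have [] := @dominated_convergence _ _ _ mu setT measurableT
  (fun J => EFin \o grid_slope N M J C)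
  (EFin \o (fun x => log_slope N x - 2 * ln (1 + M%:R^-1)))
  (EFin \o grid_bound N M C).
- by move=> J; apply/measurable_EFinP; exact: measurable_grid_slope.
- by apply/measurable_EFinP; exact: measurable_funB.
- apply: aeW => x _; apply: cvg_near_cst.
  exists (fine_digit N M x).+1 => // J /= xJ.
  by rewrite /grid_slope xJ.
- exact: grid_bound_integrable.
- by apply: aeW => x J _; rewrite /= lee_fin; exact: grid_slope_bound.
move=> _ _; rewrite fE => cvgh.
rewrite -(cvg_lim _ cvgh)//; apply: lime_le; first by apply/cvg_ex; eexists; exact: cvgh.
apply: nearW => J.
have iJ := grid_slope_integrable N_gt0 mu_acip M J C.
have /fineK IJ := integrable_fin_num measurableT iJ.
rewrite -[leLHS]IJ.
apply: (@le_trans _ _ (partition_entropy mu T (@grid R N M J))%:E).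
  by rewrite lee_fin; apply: (grid_entropy_ge N_gt0 mu_acip M0 C0 pullC).
apply: ereal_sup_ubound; exists J.+1, (@grid R N M J); split => //.
exact: grid_partition.
Qed.

Lemma KS_entropy_slope (h : R) : (\int[mu]_x (log_slope N x)%:E = h%:E)%E ->
  KS_entropy mu T = h%:E.
Proof.
move=> hE; apply/eqP; rewrite eq_le; apply/andP; split.
  apply: ge_ereal_sup => _ [k [A [pA ->]]]; rewrite lee_fin.
  exact: partition_entropy_le_slope.
apply/lee_addgt0Pr => e e0.
have [m me] : exists m : nat, 2 * m.+1%:R^-1 < e.
  exists (Num.truncn (2 / e)); rewrite ltr_pdivrMr// mulrC -ltr_pdivrMr//.
  exact: truncnS_gt.
have KS := @KS_entropy_ge_slope h m.+1 isT hE.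
apply: (@le_trans _ _ ((h - 2 * ln (1 + m.+1%:R^-1))%:E + e%:E)%E); last exact: leeD2r.
rewrite -EFinD lee_fin.
have M0 : 0 < m.+1%:R^-1 :> R by rewrite invr_gt0.
have : ln (1 + m.+1%:R^-1) <= m.+1%:R^-1 :> R by apply: le_ln1Dx; apply: lt_trans M0; lra.
by move: me; set r : R := m.+1%:R^-1; move: (ln (1 + r)) => c; lra.
Qed.

Lemma ln_size_Sigma_word (x : R) n : D x ->
  `|ln (size (Sigma_word N x n.+1))%:R - birkhoff_sum T (fun y => ln (N%:R / y)) n x| <= ln 2.
Proof.
move=> Dx; rewrite size_Sigma_word//=.
have [u0 /andP[ul ur]] := orbit_prod_bounds N_gt0 (regular_orbit_in (n := n) Dx).
move: u0 ul ur; case: (continuants _ _ n) => u v /= u0 ul ur.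
have xi0 (i : 'I_n) : 0 < N%:R / iter i T x.
  by rewrite divr_gt0 ?ltr0n//; have /andP[] := Dx i.
have PE : \prod_(i < n) (N%:R / iter i T x) = expR (birkhoff_sum T (fun y => ln (N%:R / y)) n x).
  by rewrite /birkhoff_sum expR_sum; apply: eq_bigr => i _; rewrite lnK// posrE.
rewrite PE in ul ur; set S := birkhoff_sum _ _ n x in ul ur *.
have e0 := expR_gt0 S.
rewrite ler_norml; apply/andP; split.
  have : ln (expR S / 2) <= ln u%:R by rewrite ler_ln ?posrE ?divr_gt0.
  by rewrite ln_div ?posrE// expRK; lra.
have : ln u%:R <= ln (2 * expR S) by rewrite ler_ln ?posrE ?mulr_gt0.
by rewrite lnM ?posrE// expRK; lra.
Qed.

Lemma growth_rate_cvg (x l : R) : D x ->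
  (fun n => n%:R^-1 * birkhoff_sum T (fun y => ln (N%:R / y)) n x) @ \oo --> l ->
  (fun n => n%:R^-1 * ln (size (Sigma_word N x n))%:R) @ \oo --> l.
Proof.
move=> Dx Sl; rewrite -cvg_shiftS /=; apply/cvgrPdist_le => e e0.
move/cvgrPdist_le : Sl => /(_ (e / 2)); rewrite divr_gt0// => /(_ isT) Sl.
near=> n; have n0 : 0 < n%:R :> R by rewrite ltr0n; near: n; exact: nbhs_infty_gt.
have nc : ln 2 + `|l| <= n%:R * (e / 2).
  by rewrite -ler_pdivrMr ?divr_gt0//; near: n; exact: nbhs_infty_ger.
have : `|l - n%:R^-1 * birkhoff_sum T (fun y => ln (N%:R / y)) n x| <= e / 2 by near: n.
have := ln_size_Sigma_word n Dx.
set S := birkhoff_sum _ _ n x; set L := ln _ => LS lS.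
have lS' : `|n%:R * l - S| <= n%:R * (e / 2).
  have -> : n%:R * l - S = n%:R * (l - n%:R^-1 * S).
    by rewrite mulrBr mulrA divff ?gt_eqF// mul1r.
  by rewrite normrM gtr0_norm// ler_pM2l.
have n1 : 0 < n.+1%:R :> R by rewrite ltr0n.
have -> : l - n.+1%:R^-1 * L = n.+1%:R^-1 * ((n%:R * l - S) + (S - L) + l).
  by rewrite -natr1; field; rewrite natr1 gt_eqF.
rewrite normrM gtr0_norm ?invr_gt0// ler_pdivrMl//.
apply: (le_trans (ler_normD _ _)); rewrite -lerBrDr.
apply: (le_trans (ler_normD _ _)); rewrite (distrC S) -natr1 mulrDl mul1r.
rewrite {1}[e]splitr mulrDr.
by move: (n%:R * (e / 2)) nc lS' LS e0 => c; lra.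
Unshelve. all: by end_near. Qed.

End entropy_formula.

Theorem proposition6p1 (R : realType) (N : nat)
    (mu : probability (measurableTypeR R) R)
    (hN : (1 <= N)%N) (hmu : is_acip N mu) :
  {ae (@lebesgue_measure R), forall x : R,
    0 <= x <= 1 -> irrational x ->
    (fun n : nat => (n%:R^-1 * ln (size (Sigma_word N x n))%:R)%:E) @ \oo -->
      ((2^-1)%:E * (KS_entropy mu (TN N) + (ln N%:R)%:E))%E}.
Proof.
have lni := acip_ln_integrable hN hmu.
have /fineK := integrable_fin_num measurableT lni.
set l := fine _ => /esym lE.
have slopeE : (\int[mu]_x (log_slope N x)%:E = (2 * l - ln N%:R)%:E)%E.
  have i2 : mu.-integrable setT (EFin \o cst (ln N%:R)) by exact: finite_measure_integrable_cst.
  have i3 : mu.-integrable setT (fun x => 2%:E * (ln (N%:R / x))%:E)%E by exact: integrableZl.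
  rewrite (_ : (\int[mu]_x _ = \int[mu]_x (2%:E * (ln (N%:R / x))%:E - (ln N%:R)%:E))%E)//.
  rewrite integralB// integralZl// lE; have := integral_cst mu measurableT (ln N%:R)%:E.
  by rewrite [X in (_ * X)%E]probability_setT mule1 => ->.
rewrite (KS_entropy_slope hN hmu slopeE) -EFinD -EFinM.
have -> : 2^-1 * (2 * l - ln N%:R + ln N%:R) = l by rewrite subrK; field.
have [A [mA A0 hA]] := acip_birkhoff hN hmu lni lE.
exists A; split => // x /= nx; apply: hA => /= h; apply: nx => x01 ix.
have Dx := irrational_regular hN x01 ix.
by apply: cvg_EFin; [exact: nearW|exact: growth_rate_cvg Dx (h Dx)].
Qed.
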